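(* Let $A=\{a_{kj}:\ 1\le j\le n,\ 1\le k\le d\}$ be a real matrix of size $d\times n$ ($d$ rows and $n$ columns), regarded as a linear operator $A:\mathbb R^n\to\mathbb R^d$, and let $r=\operatorname{rank}A\ge1$. For a function $f$ on $\mathbb R^d$ define $$M_Af(\mathbf x)=\sup_R\frac1{|R|}\int_R|f(\mathbf x+A\cdot\mathbf t)|\,d\mathbf t,\qquad \mathbf x\in\mathbb R^d,$$ where the supremum is over all $n$-dimensional symmetric intervals $R=\{\mathbf t=(t_1,\ldots,t_n)\in\mathbb R^n:\ t_j\in[-r_j,r_j],\ j=1,\ldots,n\}$ with $r_1,\ldots,r_n>0$. Then there is a constant $C(A)$, depending only on the matrix $A$, such that for every function $f\in L(\log^+L)^{r-1}(\mathbb R^d)$ and every $\lambda>0$, $$\left|\{\mathbf x\in\mathbb R^d:\ M_Af(\mathbf x)>\lambda\}\right|\le C(A)\int_{\mathbb R^d}\mathrm{Log}_{r-1}\left(\frac{|f|}{\lambda}\right).$$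
   Context: $|E|$ denotes Lebesgue measure. For an integer $m\ge1$ and $t\ge0$, $\mathrm{Log}_m(t)=t\left(1+\max\{0,(\log t)^m\}\right)$ (with value $0$ at $t=0$), and $\mathrm{Log}_0(t)=t$. The class $L(\log^+L)^{m}(\mathbb R^d)$, $m\ge1$, consists of the measurable $f$ on $\mathbb R^d$ with $\int_{\mathbb R^d}|f|\left(1+(\log^+|f|)^m\right)<\infty$, where $\log^+t=\max\{0,\log t\}$; for $m=0$ it is $L^1(\mathbb R^d)$. *)

(* Defs.v *)
From HB Require Import structures.
From mathcomp Require Import all_boot all_order all_algebra.
From mathcomp Require Import all_classical all_reals all_analysis.

Set Implicit Arguments.
Unset Strict Implicit.
Unset Printing Implicit Defensive.

Import Order.TTheory GRing.Theory Num.Theory.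
Import numFieldNormedType.Exports.

Local Open Scope classical_set_scope.
Local Open Scope ring_scope.

Section Lebesgue.
Context {R : realType} {d : nat}.

Definition box (a b : 'cV[R]_d) : set 'cV[R]_d :=
  [set x | forall i, a i 0 <= x i 0 <= b i 0].

(* The maximum makes the volume vanish when the box is empty and d > 0. *)
Definition box_volume (a b : 'cV[R]_d) : R :=
  \prod_(i < d) Num.max 0 (b i 0 - a i 0).

(* Covers are countable, possibly empty, sets of pairs (a, b) of corners; the
   empty cover is what gives outer measure 0 to set0 in dimension 0. *)
Definition box_cover (E : set 'cV[R]_d) : set (set ('cV[R]_d * 'cV[R]_d)) :=
  [set D | countable D /\ E `<=` \bigcup_(p in D) box p.1 p.2].

Definition lebesgue_outer (E : set 'cV[R]_d) : \bar R :=
  ereal_inf [set (\esum_(p in D) (box_volume p.1 p.2)%:E)%E | D in box_cover E].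

Local Open Scope ereal_scope.

Let box_volume_ge0 (p : 'cV[R]_d * 'cV[R]_d) : 0 <= (box_volume p.1 p.2)%:E.
Proof. by rewrite lee_fin; apply: prodr_ge0 => i _; rewrite le_max lexx. Qed.

Lemma lebesgue_outer_ge0 E : 0 <= lebesgue_outer E.
Proof.
by apply: le_ereal_inf_tmp => _ [D _ <-]; apply: esum_ge0 => p _.
Qed.

Lemma lebesgue_outer0 : lebesgue_outer set0 = 0.
Proof.
apply/eqP; rewrite eq_le lebesgue_outer_ge0 andbT.
apply: ereal_inf_lbound; exists set0; last by rewrite esum_set0.
by split; [exact: countable0|exact: sub0set].
Qed.

Lemma le_lebesgue_outer : {homo lebesgue_outer : E F / E `<=` F >-> E <= F}.
Proof.
move=> E F EF; apply: ereal_inf_le_tmp => _ [D [cD FD] <-].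
by exists D => //; split => //; exact: subset_trans EF FD.
Qed.

Let esum_bigcup_le (D : (set ('cV[R]_d * 'cV[R]_d))^nat) :
  \esum_(p in \bigcup_n D n) (box_volume p.1 p.2)%:E <=
  \sum_(n <oo) \esum_(p in D n) (box_volume p.1 p.2)%:E.
Proof.
rewrite seqDU_bigcup_eq esum_bigcupT//.
rewrite nneseries_esumT; last by move=> n; exact: esum_ge0.
apply: le_esum => n _; rewrite esum_mkcond [leRHS]esum_mkcond.
apply: le_esum => p _; case: ifPn => [|_]; last by case: ifP.
by rewrite inE => -[Dp _]; rewrite ifT// inE.
Qed.

Lemma lebesgue_outer_sigma_subadditive : sigma_subadditive lebesgue_outer.
Proof.
move=> E; have [[i ioo]|] := pselect (exists i, lebesgue_outer (E i) = +oo).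
  rewrite (eseries_pinfty _ _ ioo) ?leey// => n _.
  by rewrite -ltNye (lt_le_trans _ (lebesgue_outer_ge0 _)).
rewrite -forallNE => Eoo.
apply/lee_addgt0Pr => _/posnumP[e].
rewrite (le_trans _ (epsilon_trick _ _ _))//; last first.
  by move=> n; exact: lebesgue_outer_ge0.
pose P n D := box_cover (E n) D /\ \esum_(p in D) (box_volume p.1 p.2)%:E <=
  lebesgue_outer (E n) + (e%:num / (2 ^ n.+1)%:R)%:E.
have [G PG] : {G & forall n, P n (G n)}.
  apply: (@choice _ _ P) => n.
  have Efin : lebesgue_outer (E n) \is a fin_num.
    by rewrite ge0_fin_numE ?lebesgue_outer_ge0// ltey; apply/eqP.
  have en : (0 < e%:num / (2 ^ n.+1)%:R)%R by [].
  have [_ [D coverD <-] ltD] := lb_ereal_inf_adherent en Efin.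
  by exists D; split => //; exact: ltW.
apply: (@le_trans _ _ (\sum_(n <oo) \esum_(p in G n) (box_volume p.1 p.2)%:E)).
  apply: le_trans (esum_bigcup_le G); apply: ereal_inf_lbound.
  exists (\bigcup_n G n) => //; split.
    by apply: bigcup_countable => // n _; exact: (PG n).1.1.
  move=> x [n _ Enx]; have [p Gp px] := (PG n).1.2 _ Enx.
  by exists p => //; exists n.
apply: lee_nneseries => n _; last exact: (PG n).2.
by move=> _; exact: esum_ge0.
Qed.

HB.instance Definition _ := isOuterMeasure.Build R 'cV[R]_d lebesgue_outer
  lebesgue_outer0 lebesgue_outer_ge0 le_lebesgue_outer lebesgue_outer_sigma_subadditive.

End Lebesgue.
Arguments lebesgue_outer : clear implicits.

(* R^d with the sigma-algebra of Lebesgue measurable sets, that is Caratheodory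
   measurable sets for the Lebesgue outer measure. *)
Notation lebesgue_space R d := (caratheodory_type (lebesgue_outer R d)).

Section LebesgueMeasure.
Context (R : realType) (d : nat).

(* On a set that is not Lebesgue measurable this is the outer measure. *)
Definition lebesgue_cV : set (lebesgue_space R d) -> \bar R :=
  lebesgue_outer R d.

HB.instance Definition _ := isMeasure.Build _ (lebesgue_space R d) R lebesgue_cV
  (@caratheodory_measure0 _ _ (lebesgue_outer R d))
  (@caratheodory_measure_ge0 _ _ (lebesgue_outer R d))
  (@caratheodory_measure_sigma_additive _ _ (lebesgue_outer R d)).

End LebesgueMeasure.
Arguments lebesgue_cV : clear implicits.

Section MaximalFunction.
Context {R : realType}.

(* The maximum is outside the power: for even m the factor also exceeds 1 when
   0 < t < 1. *)
Definition Log (m : nat) (t : R) : R :=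
  if m is 0 then t else t * (1 + Num.max 0 (ln t ^+ m)).

Definition logp (t : R) : R := Num.max 0 (ln t).

(* [ln 0 = 0] in the library, so the weight is 1 where [f] vanishes. *)
Definition LlogL (m d : nat) (f : 'cV[R]_d -> R) : Prop :=
  measurable_fun [set: lebesgue_space R d] (f : lebesgue_space R d -> R) /\
  (\int[lebesgue_cV R d]_x
     (if m is 0 then `|f x| else `|f x| * (1 + logp `|f x| ^+ m))%:E < +oo)%E.

Definition symmetric_interval (n : nat) (r : 'cV[R]_n) : set 'cV[R]_n :=
  box (- r) r.

(* For almost every x the function of t is Lebesgue measurable; for the other x
   the library integral of a nonnegative function is the lower integral. *)
Definition maximal_function (d n : nat) (A : 'M[R]_(d, n)) (f : 'cV[R]_d -> R)
    (x : 'cV[R]_d) : \bar R :=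
  ereal_sup [set ((fine (lebesgue_cV R n (symmetric_interval r)))^-1%:E *
      \int[lebesgue_cV R n]_(t in symmetric_interval r) `|f (x + A *m t)|%:E)%E
    | r in [set r : 'cV[R]_n | forall j, 0 < r j 0]].

End MaximalFunction.

(* Main.v *)
(** Idea.  For a vector [v] let [M_v] be the one-dimensional maximal operator
    along the lines of direction [v].

    - [M_v] is of weak type (1,1), by transference: the flow [x + s v] preserves
      Lebesgue measure, so Tonelli reduces the inequality to the Hardy-Littlewood
      one on the real line, whatever [v] is.

    - Iterating, [M_v1 ... M_v(m+1)] satisfies the weak L (log L)^m estimate:
      [M_v g > 2b] forces [M_v (g 1_(g > b)) > b], and the integral of
      [g 1_(g > b)] is split over the levels [g > 2^k b], each level contributing
      one application of the estimate with one logarithm less.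

    - Given side lengths [r_j], write [A = L Q] with [L, Q] of rank [r] and choose
      [r] columns [J] maximizing [|det Q_J|] times the product of the [r_j] for [j]
      in [J]. By Cramer's rule every scaled column [r_j a_j] is a combination of
      the [r_i a_i], [i] in [J], with coefficients at most 1 in absolute value.
      Hence the average over the box is at most a constant times
      [M_(a_J1) ... M_(a_Jr) f (x)]. Only the translation and dilation behaviour
      of Lebesgue measure on [R^n] enters, not the exact volume of boxes.

    - A Lebesgue measurable [f] is replaced by a Borel majorant that equals [|f|]
      almost everywhere, since measurability along lines and joint measurability
      are only available for Borel functions. The majorant may have to be infinite
      on a null set. *)

Require Import Defs.
From HB Require Import structures.
From mathcomp Require Import all_boot all_order all_algebra.
From mathcomp Require Import all_classical all_reals all_analysis.
From mathcomp Require Import measurable_realfun.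
From mathcomp Require Import ring lra.

Import Order.TTheory GRing.Theory Num.Theory.
Import numFieldNormedType.Exports.
Local Open Scope classical_set_scope.
Local Open Scope ring_scope.

(** * Lebesgue outer measure: affine maps and half-spaces *)

Lemma esum_le_scale (R : realType) (T : choiceType) (D : set T) (a b : T -> R)
    (c : R) : 0 <= c -> (forall t, 0 <= a t) -> (forall t, b t <= c * a t) ->
  (\esum_(t in D) (b t)%:E <= c%:E * \esum_(t in D) (a t)%:E)%E.
Proof.
move=> c0 a0 ba; apply: ge_ereal_sup => _ [F [finF FD] <-].
apply: (@le_trans _ _ (c%:E * \sum_(i \in F) (a i)%:E)%E).
  rewrite ge0_mule_fsumr; last by move=> t; rewrite lee_fin.
  rewrite !fsbig_finite//=; apply: lee_sum => t _.
  by rewrite -EFinM lee_fin.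
apply: lee_wpmul2l; first by rewrite lee_fin.
by apply: ereal_sup_ubound; exists F.
Qed.

Section outer.
Context {R : realType} {d : nat}.
Implicit Types (E : set 'cV[R]_d) (v : 'cV[R]_d) (c : R).

Lemma box_volume_ge0 (a b : 'cV[R]_d) : 0 <= box_volume a b.
Proof. by apply: prodr_ge0 => i _; rewrite le_max lexx. Qed.

(** Moving every box of a cover of [E] by the map gives a cover of the image, and each volume is
    multiplied by [c ^+ d]. *)
Lemma lebesgue_outer_affine E c v : 0 < c ->
  (lebesgue_outer R d [set (c *: x + v)%R | x in E] <=
   (c ^+ d)%:E * lebesgue_outer R d E)%E.
Proof.
move=> c0; have cd0 : 0 < c ^+ d by rewrite exprn_gt0.
rewrite -lee_pdivrMl//; apply: le_ereal_inf_tmp => _ [D [cD ED] <-].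
rewrite lee_pdivrMl//.
pose phi (p : 'cV[R]_d * 'cV[R]_d) := (c *: p.1 + v, c *: p.2 + v).
have phiI : injective phi.
  by move=> [a b] [a' b'] [/addIr/(scalerI (lt0r_neq0 c0)) -> ];
    move=> /addIr/(scalerI (lt0r_neq0 c0)) ->.
apply: (@le_trans _ _ (\esum_(p in phi @` D) (box_volume p.1 p.2)%:E)%E).
  apply: ereal_inf_lbound; exists (phi @` D) => //; split.
    by apply: sub_countable cD; exact: card_image_le.
  move=> _ [x Ex <-]; have [p Dp px] := ED _ Ex.
  exists (phi p); first by exists p.
  by move=> i; rewrite /= !mxE !lerD2r !(ler_pM2l c0); exact: px.
rewrite (@reindex_esum _ _ _ D _ phi); last first.
  by split=> [p Dp|? ? _ _|_ [p Dp <-]]; [exists p|exact: phiI|exists p].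
apply: esum_le_scale; first exact: ltW.
  by move=> p; exact: box_volume_ge0.
move=> p /=; rewrite /box_volume.
under eq_bigr => i _ do rewrite !mxE opprD addrACA subrr addr0 -mulrBr.
rewrite -[X in _ ^+ X]card_ord -prodr_const -big_split/=.
by apply: ler_prod => i _; rewrite le_max lexx/= maxr_pMr ?mulr0 ?(ltW c0).
Qed.

Lemma lebesgue_outer_translate E v :
  lebesgue_outer R d [set (x + v)%R | x in E] = lebesgue_outer R d E.
Proof.
have H F w : (lebesgue_outer R d [set (x + w)%R | x in F] <= lebesgue_outer R d F)%E.
  have := @lebesgue_outer_affine F 1 w ltr01.
  by rewrite expr1n mul1e; under eq_imagel do rewrite scale1r.
apply/eqP; rewrite eq_le H/=.
have {1}-> : E = [set x - v | x in [set (x + v)%R | x in E]].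
  by rewrite image_comp -[LHS]image_id; apply: eq_imagel => x _ /=; rewrite addrK.
exact: H.
Qed.

Lemma lebesgue_outer_box_lty (a b : 'cV[R]_d) : (lebesgue_outer R d (box a b) < +oo)%E.
Proof.
apply: (@le_lt_trans _ _ (box_volume a b)%:E); last by rewrite ltry.
apply: ereal_inf_lbound; exists [set (a, b)].
  by split; [exact: countable1|move=> x xab; exists (a, b)].
by rewrite esum_set1// lee_fin box_volume_ge0.
Qed.

(** Generators of the Borel sets: with them Borel measurability of a vector-valued map is checked
    coordinate by coordinate, and the Caratheodory condition one hyperplane at a time. *)
Definition coord_halfspaces : set (set 'cV[R]_d) :=
  [set H | exists i c, H = [set x : 'cV[R]_d | x i 0 <= c]].

(** The hyperplane cuts each box [p] of a cover into [lo p] and [hi p], whose volumes add up to at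
    most that of [p]; the two families cover the two parts of the test set. *)
Lemma halfspace_caratheodory (i : 'I_d) c :
  (lebesgue_outer R d).-caratheodory [set x : 'cV[R]_d | x i 0 <= c].
Proof.
apply: le_caratheodory_measurable => X /=.
apply: le_ereal_inf_tmp => _ [D [cD XD] <-].
pose lo (p : 'cV[R]_d * 'cV[R]_d) :=
  (p.1, \col_j if j == i then Num.min (p.2 j 0) c else p.2 j 0).
pose hi (p : 'cV[R]_d * 'cV[R]_d) :=
  (\col_j (if j == i then Num.max (p.1 j 0) c else p.1 j 0), p.2).
have volD p : box_volume (lo p).1 (lo p).2 + box_volume (hi p).1 (hi p).2
   <= box_volume p.1 p.2.
  rewrite /box_volume !(bigD1 (P := predT) i)//= !mxE eqxx.
  under [X in _ * X + _]eq_bigr => j ji do rewrite !mxE (negbTE ji).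
  under [X in _ + _ * X]eq_bigr => j ji do rewrite !mxE (negbTE ji).
  rewrite -mulrDl; apply: ler_wpM2r.
    by apply: prodr_ge0 => j _; rewrite le_max lexx.
  by rewrite /Num.max /Num.min; repeat case: ifPn; rewrite -?leNgt; lra.
have cover (phi : 'cV[R]_d * 'cV[R]_d -> 'cV[R]_d * 'cV[R]_d) Y :
    (forall p x, Y x -> box p.1 p.2 x -> box (phi p).1 (phi p).2 x) ->
  (lebesgue_outer R d (X `&` Y) <= \esum_(p in D) (box_volume (phi p).1 (phi p).2)%:E)%E.
  move=> phiY; apply: (@le_trans _ _ (\esum_(p in phi @` D) (box_volume p.1 p.2)%:E)%E).
    apply: ereal_inf_lbound; exists (phi @` D) => //; split.
      by apply: sub_countable cD; exact: card_image_le.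
    move=> x [Xx Yx]; have [p Dp px] := XD _ Xx.
    by exists (phi p); [exists p|exact: phiY].
  (* Distinct boxes may be cut to the same piece, which the image counts once: [D'] keeps one
     preimage of each piece. *)
  have [D' [D'D phiD']] : exists D', D' `<=` D /\ set_bij D' (phi @` D) phi.
    pose g q := xget point [set p | D p /\ phi p = q].
    have gP q : (phi @` D) q -> D (g q) /\ phi (g q) = q.
      by move=> [p Dp pq]; apply: (@xgetPex _ point [set p | D p /\ phi p = q]); exists p.
    exists (g @` (phi @` D)); split; first by move=> _ [q /gP[? _] <-].
    split => [_ [q qD <-]|q q' /set_mem[u uD <-] /set_mem[u' u'D <-]|q qD].
    - by rewrite (gP _ qD).2.
    - by rewrite (gP _ uD).2 (gP _ u'D).2 => ->.
    - by exists (g q); [exists q|exact: (gP _ qD).2].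
  rewrite (@reindex_esum _ _ _ D' _ phi _ phiD') esum_mkcond [leRHS]esum_mkcond.
  apply: le_esum => p _; case: ifPn => [|_].
    by rewrite inE => /D'D ?; rewrite ifT ?inE.
  by case: ifPn => // _; rewrite lee_fin box_volume_ge0.
apply: (@le_trans _ _ (\esum_(p in D) ((box_volume (lo p).1 (lo p).2)%:E +
    (box_volume (hi p).1 (hi p).2)%:E))%E).
  rewrite esumD; [|by move=> *; rewrite lee_fin box_volume_ge0..].
  apply: leeD; apply: cover => p x /= xc px j; rewrite !mxE.
    by case: eqP => [ji|_]; last exact: px; rewrite le_min andbA px/= ji.
  case: eqP => [ji|_]; last exact: px.
  by rewrite ge_max andbAC px/= ji; apply: ltW; rewrite ltNge; apply/negP.
by apply: le_esum => p _; rewrite -EFinD lee_fin.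
Qed.

End outer.

(** * Borel sets of column vectors *)

Definition borel_space (R : realType) (d : nat) :=
  g_sigma_algebraType (@coord_halfspaces R d).
HB.instance Definition _ (R : realType) (d : nat) := Measurable.on (borel_space R d).

Section borel_measure.
Context (R : realType) (d : nat).
Local Notation X := (borel_space R d).

Lemma borel_caratheodory (E : set X) : measurable E ->
  (lebesgue_outer R d).-caratheodory E.
Proof.
have sigmaT : sigma_algebra setT (lebesgue_outer R d).-caratheodory.
  split; [exact: caratheodory_measurable_set0|move=> A mA|].
    by rewrite setTD; exact: caratheodory_measurable_setC.
  exact: caratheodory_measurable_bigcup.
apply: smallest_sub => // _ [i [c ->]]; exact: halfspace_caratheodory.
Qed.

Definition borel_measure : set X -> \bar R := lebesgue_outer R d.

Let borel_measure0 : borel_measure set0 = 0%E.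
Proof. exact: lebesgue_outer0. Qed.

Let borel_measure_ge0 E : (0 <= borel_measure E)%E.
Proof. exact: lebesgue_outer_ge0. Qed.

Let borel_measure_sigma_additive : semi_sigma_additive borel_measure.
Proof.
move=> F mF tF mUF.
apply: (@caratheodory_measure_sigma_additive _ _ (lebesgue_outer R d)) => //.
  by move=> i; exact: borel_caratheodory.
exact: borel_caratheodory.
Qed.

HB.instance Definition _ := isMeasure.Build _ X R borel_measure
  borel_measure0 borel_measure_ge0 borel_measure_sigma_additive.

Lemma measurable_coord (i : 'I_d) : measurable_fun [set: X] (fun x : X => x i 0 : R).
Proof.
apply: (measurability _ (measurable_realfun.RGenOInfty.measurableE R)).
move=> _ [_ [c ->] <-]; rewrite setTI.
rewrite [X in measurable X](_ : _ = ~` [set x : 'cV[R]_d | x i 0 <= c]).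
  by apply: measurableC; apply: sub_sigma_algebra; exists i, c.
by apply/seteqP; split => x /=; rewrite in_itv/= andbT ltNge => /negP.
Qed.

Lemma measurable_to_borel {d'} (T : measurableType d') (f : T -> X) :
  (forall i, measurable_fun [set: T] (fun t => f t i 0 : R)) ->
  measurable_fun [set: T] f.
Proof.
move=> mf; apply: (@measurability _ _ T X _ _ (@coord_halfspaces R d)) => //.
move=> _ [_ [i [c ->]] <-].
have := mf i measurableT `]-oo, c]%classic (measurable_itv _).
by congr measurable; apply/seteqP; split => t /=; rewrite in_itv.
Qed.

Lemma measurable_box (a b : 'cV[R]_d) : measurable (box a b : set X).
Proof.
rewrite [X in measurable X](_ : _ = \bigcap_(i in [set: 'I_d])
    ([set: X] `&` (fun x : X => x i 0 : R) @^-1` `[a i 0, b i 0]%classic)).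
  apply: fin_bigcap_measurable => // i _.
  exact: (measurable_coord i).
apply/seteqP; split => [x xab i _|x xab i].
  by split => //=; rewrite in_itv/=; exact: xab.
by have [_ /=] := xab i I; rewrite in_itv.
Qed.

Let borel_measure_sigma_finite : sigma_finite setT borel_measure.
Proof.
exists (fun k => box (- const_mx k%:R) (const_mx k%:R)); last first.
  by move=> k; split; [exact: measurable_box|exact: lebesgue_outer_box_lty].
apply/esym/seteqP; split => // x _.
exists (Num.bound (\sum_i `|x i 0|)) => // i.
rewrite !mxE -ler_norml; apply: (@le_trans _ _ (\sum_i `|x i 0|)).
  by rewrite (bigD1 i)//= lerDl sumr_ge0.
by apply: ltW; apply: le_lt_trans (archi_boundP _); rewrite ?sumr_ge0.
Qed.

HB.instance Definition _ := @Measure_isSigmaFinite.Build _ X R borel_measure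
  borel_measure_sigma_finite.

(** [borel_measure] is the pushforward of [lebesgue_cV] by the identity, which is measurable because
    Borel sets are Caratheodory measurable. *)
Lemma ge0_integral_borel (f : X -> \bar R) : measurable_fun [set: X] f ->
  (forall x, 0 <= f x)%E ->
  (\int[borel_measure]_x f x = \int[lebesgue_cV R d]_x f x)%E.
Proof.
move=> mf f0.
have mid : measurable_fun [set: lebesgue_space R d] (id : lebesgue_space R d -> X).
  by move=> _ E mE; rewrite setTI; exact: borel_caratheodory.
by have := @ge0_integral_pushforward _ _ _ _ R _ mid (lebesgue_cV R d) setT f
  measurableT mf (fun x _ => f0 x).
Qed.

Lemma measurable_translate (v : 'cV[R]_d) :
  measurable_fun [set: X] (fun x : X => (x + v)%R : X).
Proof.
apply: measurable_to_borel => i.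
under eq_fun do rewrite mxE.
by apply: measurable_funD => //; exact: measurable_coord.
Qed.

Lemma ge0_integral_translate (f : X -> \bar R) v : measurable_fun [set: X] f ->
  (forall x, 0 <= f x)%E ->
  (\int[borel_measure]_x f (x + v)%R = \int[borel_measure]_x f x)%E.
Proof.
move=> mf f0.
have := @ge0_integral_pushforward _ _ _ _ R _ (measurable_translate v) borel_measure setT f
  measurableT mf (fun x _ => f0 x).
rewrite preimage_setT => <-; apply: eq_measure_integral => [|mv E mE _].
  exact: measurable_translate.
have EE : E = [set (x + v)%R | x in (fun x : 'cV[R]_d => (x + v)%R) @^-1` E].
  apply/seteqP; split => [x Ex|_ [x /= Ex <-]//].
  by exists (x - v); rewrite /= subrK.
by rewrite [in RHS]EE; exact/esym/lebesgue_outer_translate.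
Qed.

End borel_measure.

Lemma measurable_flow (R : realType) (d : nat) (v : 'cV[R]_d) :
  measurable_fun [set: borel_space R d * R]
    (fun z => (z.1 + z.2 *: v)%R : borel_space R d).
Proof.
apply: measurable_to_borel => i.
under eq_fun do rewrite !mxE.
apply: measurable_funD; last exact: measurable_funM.
exact: (measurableT_comp (measurable_coord R d i) measurable_fst).
Qed.

Lemma measurable_affine (R : realType) (d n : nat) (A : 'M[R]_(d, n)) (x : 'cV[R]_d) :
  measurable_fun [set: borel_space R n]
    (fun t => (x + A *m t)%R : borel_space R d).
Proof.
apply: measurable_to_borel => i.
under eq_fun do rewrite !mxE.
apply: measurable_funD => //; apply: measurable_sum => j.
by apply: measurable_funM => //; exact: measurable_coord.
Qed.

(** * The one-dimensional weak type inequality *)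

(* No measurability: the integral of a nonnegative function is the supremum of
   the integrals of the simple functions below it. *)
Lemma le_lower_integral d (T : measurableType d) (R : realType)
    (mu : {measure set T -> \bar R}) (D : set T) (f g : T -> \bar R) :
  (forall x, D x -> 0 <= f x)%E -> (forall x, D x -> f x <= g x)%E ->
  (\int[mu]_(x in D) f x <= \int[mu]_(x in D) g x)%E.
Proof.
move=> f0 fg; rewrite !ge0_integralE//; last first.
  by move=> x Dx; exact: le_trans (f0 _ Dx) (fg _ Dx).
apply: ereal_sup_le => _ [h /= hf <-]; exists h => //= x.
apply: le_trans (hf x) _; rewrite /patch; case: ifPn => // /set_mem; exact: fg.
Qed.

Section real_line.
Context {R : realType}.
Local Notation leb := (@lebesgue_measure R).

(** The pushforward of [leb] by the shift agrees with [leb] on half-open intervals, hence everywhere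
    by uniqueness. *)
Lemma ge0_integral_shift (h : R -> \bar R) (D : set R) (c : R) :
  measurable D -> measurable_fun [set: R] h -> (forall t, 0 <= h t)%E ->
  (\int[leb]_(t in (fun t => (c + t)%R) @^-1` D) h (c + t)%R
   = \int[leb]_(t in D) h t)%E.
Proof.
move=> mD mh h0.
have mphi : measurable_fun [set: measurableTypeR R]
    (fun t : measurableTypeR R => (c + t)%R : measurableTypeR R).
  exact: measurable_funD.
have := @ge0_integral_pushforward _ _ _ _ R _ mphi leb D h mD
  (measurable_funS measurableT (@subsetT _ D) mh) (fun x _ => h0 x).
move=> <-; apply: eq_measure_integral => E mE _.
apply/esym/lebesgue_measure_unique => // _ [[a b]] _ <-.
rewrite /= /pushforward (_ : _ @^-1` _ = `](a - c), (b - c)]%classic); last first.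
  by apply/seteqP; split => x /=; rewrite !in_itv/=; lra.
rewrite /= !lebesgue_measure_itv/= !lte_fin ltrD2r.
by case: ifP => // _; rewrite -!EFinB; congr EFin; lra.
Qed.

(** Centres in []-N, N[] and radii at most [N] only see [h] on []-2N, 2N[]. If its integral there is
    finite, the truncation of [h] is almost everywhere equal to a real locally integrable function,
    for which the maximal inequality with constant 3 is known. *)
Lemma hl_weak_type (h : R -> \bar R) (N lambda : R) (B : set R) :
  0 < N -> 0 < lambda -> measurable_fun [set: R] h -> (forall t, 0 <= h t)%E ->
  (forall s, B s -> - N < s < N /\ exists rho, [/\ 0 < rho, rho <= N &
     (lambda%:E < ((2 * rho)^-1)%:E *
        \int[leb]_(t in `](- rho)%R, rho[) h (s + t)%R)%E]) ->
  measurable B ->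
  (leb B <= (3 / lambda)%:E * \int[leb]_(t in `](- 2 * N)%R, (2 * N)%R[) h t)%E.
Proof.
move=> N0 l0 mh h0 BP mB.
set D : set R := `](- 2 * N), (2 * N)[%classic.
have mD : measurable D by exact: measurable_itv.
have [->|/eqP] := eqVneq (\int[leb]_(t in D) h t)%E +oo%E.
  by rewrite gt0_muley ?leey// lte_fin divr_gt0.
move=> /eqP; rewrite -ltey => foo.
pose f := fine \o (h \_ D).
have mhD : measurable_fun [set: R] (h \_ D).
  by apply/(measurable_restrictT _ _).1 => //; exact: measurable_funTS.
have hD0 t : (0 <= (h \_ D) t)%E by apply: erestrict_ge0.
have mf : measurable_fun [set: R] f by exact: measurableT_comp.
have f0 t : 0 <= f t by rewrite fine_ge0.
have iD : leb.-integrable [set: R] (h \_ D).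
  apply/integrableP; split => //.
  by under eq_integral do rewrite gee0_abs//; rewrite -integral_mkcond.
have ae_f : ae_eq leb [set: R] (h \_ D) (EFin \o f).
  have := integrable_ae measurableT iD.
  by apply: filterS => t /(_ I) ht _; rewrite /f /= fineK.
have If E : measurable E -> (\int[leb]_(t in E) (h \_ D) t = \int[leb]_(t in E) `|(f t)%:E|)%E.
  move=> mE; under [RHS]eq_integral do rewrite gee0_abs ?lee_fin//.
  apply: ge0_ae_eq_integral => //.
  - exact: measurable_funTS.
  - by apply/measurable_EFinP; exact: measurable_funTS.
  - by move=> t _; rewrite lee_fin.
  - exact: ae_eq_subset ae_f.
have locf : locally_integrable [set: R] f.
  apply: open_integrable_locally; first exact: openT.
  apply/integrableP; split; first exact/measurable_EFinP.
  by rewrite -If// -integral_mkcond.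
apply: (@le_trans _ _ (leb [set x | lambda%:E < HL_maximal f x]%E)).
  apply: le_measure; rewrite ?inE//.
    rewrite -[X in measurable X]setTI.
    by apply: emeasurable_fun_o_infty => //; exact: measurable_HL_maximal.
  move=> s /BP[sN [rho [rho0 rhoN]]] /lt_le_trans; apply.
  apply: le_ereal_sup_tmp; exists (iavg f (ball s rho)).
    by exists rho => //=; rewrite in_itv/= rho0.
  rewrite /iavg lebesgue_measure_ball ?(ltW rho0)// -If; last exact: measurable_ball.
  rewrite inver mulrn_eq0/= (gt_eqF rho0).
  rewrite -(@ge0_integral_shift (h \_ D) (ball s rho) s)//; last exact: measurable_ball.
  rewrite (_ : _ @^-1` _ = `]-rho, rho[%classic); last first.
    by rewrite ball_itv; apply/seteqP; split => x /=; rewrite !in_itv/=; lra.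
  rewrite le_eqVlt; apply/orP; left; apply/eqP; congr (_ * _)%E.
    by rewrite mulr_natl.
apply: eq_integral => t /[!inE]/=; rewrite in_itv/= => trho.
  rewrite patchE ifT// inE /D/= in_itv/=.
  by move: sN; lra.
apply: le_trans (maximal_inequality locf l0) _.
by rewrite -If// -integral_mkcond.
Qed.

End real_line.

(** * Maximal operators along lines *)

Section tonelli_restrict.
Context {R : realType} {d'} (T : measurableType d')
  (m : {sigma_finite_measure set T -> \bar R}).
Local Notation leb := (@lebesgue_measure R).
Variables (Phi : T * R -> \bar R) (D : set R).
Hypotheses (mD : measurable D) (mPhi : measurable_fun [set: T * R] Phi)
  (Phi0 : forall z, (0 <= Phi z)%E).

(** Extension by zero turns integrals over [D] into integrals over the whole line, where Tonelli's
    theorem applies. *)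
Let Psi : T * R -> \bar R := Phi \_ ([set: T] `*` D).

Let mPsi : measurable_fun [set: T * R] Psi.
Proof.
apply/(measurable_restrictT _ _).1; first exact: measurableX.
exact: measurable_funTS.
Qed.

Let Psi0 z : (0 <= Psi z)%E.
Proof. exact: erestrict_ge0. Qed.

Let PsiE x : (\int[leb]_(s in D) Phi (x, s) = \int[leb]_s Psi (x, s))%E.
Proof.
rewrite integral_mkcond; apply: eq_integral => s _.
by rewrite /Psi !patchE in_setX in_setT.
Qed.

Lemma measurable_integral_snd :
  measurable_fun [set: T] (fun x => (\int[leb]_(s in D) Phi (x, s))%E).
Proof.
by under eq_fun do rewrite PsiE; exact: measurable_fun_fubini_tonelli_F.
Qed.

Lemma tonelli_restrict :
  (\int[m]_x \int[leb]_(s in D) Phi (x, s) =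
   \int[leb]_(s in D) \int[m]_x Phi (x, s))%E.
Proof.
under eq_integral do rewrite PsiE.
have := @fubini_tonelli1 _ _ _ _ _ m leb _ mPsi Psi0.
have := @fubini_tonelli2 _ _ _ _ _ m leb _ mPsi Psi0.
rewrite /fubini_F /fubini_G => -> <-.
rewrite [RHS]integral_mkcond; apply: eq_integral => s _.
rewrite patchE; case: ifPn => sD; last first.
  by apply: integral0_eq => x _; rewrite /Psi patchE in_setX (negbTE sD) andbF.
by apply: eq_integral => x _; rewrite /Psi patchE in_setX sD in_setT.
Qed.

End tonelli_restrict.

Section flow.
Context {R : realType} {d : nat}.
Local Notation X := (borel_space R d).
Local Notation mu := (borel_measure R d).
Local Notation leb := (@lebesgue_measure R).
Implicit Types (v : 'cV[R]_d) (g : X -> \bar R) (rho : R) (x : X).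

(** The radius is measured in the parameter [s]: [v] is not normalised and may be zero. *)
Definition flow_avg v rho g x : \bar R :=
  (((2 * rho)^-1)%:E * \int[leb]_(s in `](- rho)%R, rho[) g (x + s *: v)%R)%E.

Lemma measurable_flow_integral v g (D : set R) : measurable D ->
  measurable_fun [set: X] g -> (forall x, 0 <= g x)%E ->
  measurable_fun [set: X] (fun x : X => (\int[leb]_(s in D) g (x + s *: v)%R)%E).
Proof.
move=> mD mg g0.
have := @measurable_integral_snd R _ X (fun z => g (z.1 + z.2 *: v)%R) D mD.
apply => //; exact: (measurableT_comp mg (measurable_flow R d v)).
Qed.

Lemma measurable_flow_line v g x : measurable_fun [set: X] g ->
  measurable_fun [set: R] (fun s => g (x + s *: v)%R).
Proof.
move=> mg; apply: (measurableT_comp mg); apply: measurable_to_borel => i.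
under eq_fun do rewrite !mxE.
by apply: measurable_funD => //; exact: measurable_funM.
Qed.

(** After Tonelli the integral in [x] does not depend on [s], by translation invariance. *)
Lemma integral_flow_integral v g (D : set R) : measurable D ->
  measurable_fun [set: X] g -> (forall x, 0 <= g x)%E ->
  (\int[mu]_x \int[leb]_(s in D) g (x + s *: v)%R = (\int[mu]_x g x) * leb D)%E.
Proof.
move=> mD mg g0.
have := @tonelli_restrict R _ X mu (fun z => g (z.1 + z.2 *: v)%R) D mD.
move=> -> //; last exact: (measurableT_comp mg (measurable_flow R d v)).
under eq_integral do rewrite /= (ge0_integral_translate _ _ _ _ mg g0).
by rewrite integral_cst.
Qed.

Lemma measurable_flow_avg v rho g :
  measurable_fun [set: X] g -> (forall x, 0 <= g x)%E ->
  measurable_fun [set: X] (flow_avg v rho g).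
Proof.
move=> mg g0; apply: measurable_funeM.
by apply: measurable_flow_integral => //; exact: measurable_itv.
Qed.

Lemma flow_avg_ge0 v rho g x : 0 < rho -> (forall x, 0 <= g x)%E ->
  (0 <= flow_avg v rho g x)%E.
Proof.
move=> r0 g0; rewrite /flow_avg mule_ge0 ?integral_ge0//.
by rewrite lee_fin invr_ge0 mulr_ge0// ltW.
Qed.

(* Transference: for fixed x, Hardy-Littlewood on the line s |-> x + s v bounds
   the measure of the s in ]-N, N[ with x + s v in F; integrating over x turns
   this into 2 N mu(F) <= (3 / lambda) 4 N \int g. *)
Lemma flow_weak_type_finite v g (lambda N : R) (F : set X) :
  0 < lambda -> 0 < N -> measurable_fun [set: X] g -> (forall x, 0 <= g x)%E ->
  measurable F ->
  (forall x, F x -> exists rho, [/\ 0 < rho, rho <= N &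
     (lambda%:E < flow_avg v rho g x)%E]) ->
  (mu F <= (6 / lambda)%:E * \int[mu]_x g x)%E.
Proof.
move=> l0 N0 mg g0 mF FP.
pose D : set R := `](- N), N[%classic.
pose D2 : set R := `](- 2 * N), (2 * N)[%classic.
have mD : measurable D by exact: measurable_itv.
have mD2 : measurable D2 by exact: measurable_itv.
have lebD : leb D = (2 * N)%:E.
  by rewrite /D lebesgue_measure_itv/= lte_fin ifT ?gtrN// -EFinB; congr EFin; lra.
have lebD2 : leb D2 = (4 * N)%:E.
  by rewrite /D2 lebesgue_measure_itv/= lte_fin ifT -?EFinB; [congr EFin; lra|lra].
have mF1 : measurable_fun [set: X] (fun x : X => (\1_F x : R)%:E).
  by apply/measurable_EFinP; exact: measurable_indic.
have F10 x : (0 <= (\1_F x : R)%:E)%E by rewrite lee_fin.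
have := integral_flow_integral v _ _ mD mF1 F10.
rewrite integral_indic// setIT lebD => eqF.
have := integral_flow_integral v _ _ mD2 mg g0.
rewrite lebD2 => eqg.
have le_int : (\int[mu]_x \int[leb]_(s in D) (\1_F (x + s *: v)%R : R)%:E <=
    \int[mu]_x ((3 / lambda)%:E * \int[leb]_(s in D2) g (x + s *: v)%R))%E.
  apply: le_lower_integral => x _; first by apply: integral_ge0 => s _; rewrite lee_fin.
  have mline : measurable_fun [set: R] (fun s => (x + s *: v)%R : X).
    apply: measurable_to_borel => i; under eq_fun do rewrite !mxE.
    by apply: measurable_funD => //; exact: measurable_funM.
  have mB : measurable ((fun s => (x + s *: v)%R : X) @^-1` F).
    by rewrite -[X in measurable X]setTI; exact: mline.
  have -> : (\int[leb]_(s in D) (\1_F (x + s *: v)%R : R)%:E =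
      leb (((fun s => (x + s *: v)%R : X) @^-1` F) `&` D))%E.
    by rewrite -integral_indic.
  apply: (@hl_weak_type R (fun s => g (x + s *: v)%R) N) => //.
  - exact: measurable_flow_line.
  - move=> s [/= Fs]; rewrite /D /= in_itv /= => sN; split => //.
    have [rho [rho0 rhoN lrho]] := FP _ Fs; exists rho; split => //.
    by under eq_integral do rewrite scalerDl addrA.
  - exact: measurableI.
rewrite ge0_integralZl_EFin//= in le_int; last 3 first.
- by move=> x _; exact: integral_ge0.
- exact: measurable_flow_integral.
- by rewrite divr_ge0// ltW.
move: le_int; rewrite eqF eqg muleA muleAC -EFinM => le_int.
rewrite -(@lee_pmul2r _ (2 * N)%:E)//; last by rewrite lte_fin mulr_gt0.
apply: le_trans le_int _; rewrite muleAC -EFinM.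
by rewrite le_eqVlt; apply/orP; left; apply/eqP; congr (_%:E * _)%E; field; rewrite gt_eqF.
Qed.

(* The positive rationals: a countable supremum keeps [flow_maximal] measurable,
   and costs a factor 2 against the supremum over all radii. *)
Definition radius (k : nat) : R :=
  if unpickle k is Some (p, q) then p.+1%:R / q.+1%:R else 1.

Lemma radius_gt0 k : 0 < radius k.
Proof. by rewrite /radius; case: unpickle => [[p q]|//]; rewrite divr_gt0. Qed.

Lemma radiusP rho : 0 < rho -> exists k, rho <= radius k <= 2 * rho.
Proof.
(* The fraction [(p + 1) / (q + 1)] is above [rho] by at most [1 / (q + 1)], which is at most [rho]
   because [q > 1 / rho]. *)
move=> r0; set q := Num.bound rho^-1; set p := Num.truncn (rho * q.+1%:R).
have q0 : 0 < q.+1%:R :> R by rewrite ltr0n.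
exists (pickle (p, q)); rewrite /radius pickleK ler_pdivlMr// ler_pdivrMr//.
have : 1 <= rho * q.+1%:R.
  rewrite mulrC -ler_pdivrMr// div1r -natr1.
  have : rho^-1 < q%:R by apply: archi_boundP; rewrite invr_ge0 ltW.
  lra.
have := truncn_itv (ltW (mulr_gt0 r0 q0)); rewrite -/p -!natr1 !mulrDr.
lra.
Qed.

Definition flow_maximal v g x : \bar R :=
  ereal_sup (range (fun k => flow_avg v (radius k) g x)).

Lemma flow_avg_le_maximal v rho g x : 0 < rho ->
  measurable_fun [set: X] g -> (forall x, 0 <= g x)%E ->
  (flow_avg v rho g x <= 2%:E * flow_maximal v g x)%E.
Proof.
move=> r0 mg g0; have [k /andP[rk k2]] := radiusP _ r0.
apply: (@le_trans _ _ (2%:E * flow_avg v (radius k) g x)%E); last first.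
  by apply: lee_wpmul2l; [rewrite lee_fin|apply: ereal_sup_ubound; exists k].
rewrite /flow_avg muleA -EFinM.
have rk0 := radius_gt0 k.
apply: lee_pmul.
- by rewrite lee_fin invr_ge0; lra.
- exact: integral_ge0.
- by rewrite lee_fin ler_pdivlMr ?mulr_gt0// mulrC ler_pdivrMr ?mulr_gt0//; lra.
- apply: ge0_subset_integral => //; try exact: measurable_itv.
    by apply: measurable_funTS; exact: measurable_flow_line.
  by move=> s /=; rewrite !in_itv/=; lra.
Qed.

Lemma flow_maximal_ge0 v g x : (forall x, 0 <= g x)%E -> (0 <= flow_maximal v g x)%E.
Proof.
move=> g0; apply: (@le_trans _ _ (flow_avg v (radius 0) g x)).
  exact: flow_avg_ge0 (radius_gt0 _) g0.
by apply: ereal_sup_ubound; exists 0%N.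
Qed.

Lemma measurable_flow_maximal v g :
  measurable_fun [set: X] g -> (forall x, 0 <= g x)%E ->
  measurable_fun [set: X] (flow_maximal v g).
Proof.
move=> mg g0.
have -> : flow_maximal v g = fun x => esups (fun k => flow_avg v (radius k) g x) 0.
  apply/funext => x; rewrite /flow_maximal /esups; congr ereal_sup.
  by apply/seteqP; split => _ [k _ <-]; exists k.
by apply: measurable_fun_esups => k; exact: measurable_flow_avg.
Qed.

Lemma flow_maximal_le v g h x :
  measurable_fun [set: X] g -> measurable_fun [set: X] h ->
  (forall x, 0 <= g x)%E -> (forall x, g x <= h x)%E ->
  (flow_maximal v g x <= flow_maximal v h x)%E.
Proof.
move=> mg mh g0 gh; apply: ge_ereal_sup => _ [k _ <-].
apply: (@le_trans _ _ (flow_avg v (radius k) h x)).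
  apply: lee_wpmul2l; first by rewrite lee_fin invr_ge0 mulr_ge0// ltW// radius_gt0.
  by apply: le_lower_integral => s _.
by apply: ereal_sup_ubound; exists k.
Qed.

(** The average of a constant is that constant. This discards the part of a function below a given
    height at the cost of that height. *)
Lemma flow_maximalD v g (a : R) x : 0 <= a ->
  measurable_fun [set: X] g -> (forall x, 0 <= g x)%E ->
  (flow_maximal v (fun x => g x + a%:E) x <= flow_maximal v g x + a%:E)%E.
Proof.
move=> a0 mg g0; apply: ge_ereal_sup => _ [k _ <-]; have rk0 := radius_gt0 k.
apply: (@le_trans _ _ (flow_avg v (radius k) g x + a%:E)%E); last first.
  by apply: leeD => //; apply: ereal_sup_ubound; exists k.
rewrite /flow_avg ge0_integralD//; last first.
  by apply: measurable_funTS; exact: measurable_flow_line.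
rewrite integral_cst//= lebesgue_measure_itv/= lte_fin ifT ?gtrN//.
rewrite ge0_muleDr ?integral_ge0//; last by rewrite mule_ge0// lee_fin ?subr_ge0; lra.
apply: leeD => //; rewrite -EFinB -!EFinM lee_fin.
by rewrite le_eqVlt; apply/orP; left; apply/eqP; field; lra.
Qed.

(** Finitely many radii are bounded by some [N], and the constant of [flow_weak_type_finite] does
    not depend on [N]; the level sets for the first [K] radii increase to the full one. *)
Lemma flow_weak_type v g (lambda : R) :
  0 < lambda -> measurable_fun [set: X] g -> (forall x, 0 <= g x)%E ->
  (mu [set x | lambda%:E < flow_maximal v g x]%E <= (6 / lambda)%:E * \int[mu]_x g x)%E.
Proof.
move=> l0 mg g0.
pose F (K : nat) : set X :=
  \bigcup_(k in `I_K) [set x | (lambda%:E < flow_avg v (radius k) g x)%E].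
have mF K : measurable (F K).
  apply: bigcup_measurable => k _; rewrite -[X in measurable X]setTI.
  by apply: emeasurable_fun_o_infty => //; exact: measurable_flow_avg.
have FE : [set x | (lambda%:E < flow_maximal v g x)%E] = \bigcup_K F K.
  apply/seteqP; split => [x /ereal_sup_gt[_ [k _ <-]] lk|x [K _ [k _ lk]]].
    by exists k.+1 => //; exists k => //=.
  by apply: lt_le_trans lk _; apply: ereal_sup_ubound; exists k.
rewrite FE.
have cvgF : mu \o F @ \oo --> mu (\bigcup_K F K).
  apply: nondecreasing_cvg_mu => //; first exact: bigcup_measurable.
  apply/nondecreasing_seqP => K; apply/subsetPset => x [k /= kK xk].
  by exists k => //=; exact: ltnW.
rewrite -(cvg_lim _ cvgF)//; apply: lime_le; first by apply/cvg_ex; eexists; exact: cvgF.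
apply: nearW => K /=.
(* The sum bounds each of its radii; the 1 keeps the bound positive when [K] is 0. *)
apply: (@flow_weak_type_finite v g lambda (1 + \sum_(k < K) radius k)) => //.
  by rewrite ltr_pwDl// sumr_ge0// => k _; rewrite ltW// radius_gt0.
move=> x [k /= kK lk]; exists (radius k); split => //; first exact: radius_gt0.
rewrite (bigD1 (Ordinal kK))//= addrCA lerDl addr_ge0// sumr_ge0// => i _.
exact/ltW/radius_gt0.
Qed.

End flow.

(** * The L (log L)^m estimate for iterated maximal operators *)

Section weight.
Context {R : realType}.
Implicit Types (t w : R) (m : nat).

Lemma logp_ge0 t : 0 <= logp t.
Proof. by rewrite /logp le_max lexx. Qed.

Lemma logp0 : logp (0 : R) = 0.
Proof. by rewrite /logp ln0// maxxx. Qed.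

Lemma le_logp t w : 0 < t -> t <= w -> logp t <= logp w.
Proof.
move=> t0 tw; rewrite /logp ge_max !le_max lexx/=; apply/orP; right.
by rewrite ler_ln// posrE (lt_le_trans t0).
Qed.

Lemma logpM_le t w : 1 <= w -> 0 <= t -> logp (w * t) <= w + logp t.
Proof.
move=> w1; rewrite le_eqVlt => /predU1P[<-|t0].
  by rewrite mulr0 logp0 addr0; lra.
have lnw : ln w <= w - 1.
  have : ln (1 + (w - 1)) <= w - 1 by apply: le_ln1Dx; lra.
  by rewrite addrC subrK.
have w0 : 0 < w by lra.
have := logp_ge0 t; rewrite [logp (w * t)]/logp ge_max lnM ?posrE//.
have : ln t <= logp t by rewrite /logp le_max lexx orbT.
move=> ? ?; apply/andP; split; lra.
Qed.

(* Comparable to [Log m t] for t >= 1, but without its increase on ]0, 1[ for even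
   m: dilations of t only cost a constant factor. *)
Definition Phi m t : R := t * (1 + logp t) ^+ m.

Lemma Phi_ge0 m t : 0 <= t -> 0 <= Phi m t.
Proof. by move=> t0; rewrite mulr_ge0// exprn_ge0// addr_ge0// logp_ge0. Qed.

Lemma measurable_logp : measurable_fun [set: R] (@logp R).
Proof. by apply: measurable_maxr => //; exact: measurable_ln. Qed.

Lemma measurable_Phi m : measurable_fun [set: R] (Phi m).
Proof.
apply: measurable_funM => //; apply: measurable_funX.
by apply: measurable_funD => //; exact: measurable_logp.
Qed.

(** From [logp (w * t) <= w + logp t] one gets [1 + logp (w * t) <= (1 + w) * (1 + logp t)]. *)
Lemma Phi_scale m t w : 1 <= w -> 0 <= t ->
  Phi m (w * t) <= w * (1 + w) ^+ m * Phi m t.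
Proof.
move=> w1 t0; have lt := logp_ge0 t.
rewrite /Phi -mulrA [leRHS](_ : _ = w * t * ((1 + w) * (1 + logp t)) ^+ m); last first.
  by rewrite exprMn; ring.
rewrite -mulrA; apply: ler_wpM2l; first lra.
apply: ler_wpM2l => //; apply: lerXn2r; rewrite ?nnegrE.
- by have := logp_ge0 (w * t); lra.
- by rewrite mulr_ge0//; lra.
- have : 0 <= w * logp t by rewrite mulr_ge0//; lra.
  by have := logpM_le _ _ w1 t0; lra.
Qed.

(** If [2 ^+ n < w] then [n * ln 2 <= ln w], and [ln 2 >= 1 / 2]; the earlier terms are at most [n]
    in total. *)
Lemma dyadic_count w n : \sum_(k < n) (2 ^+ k < w)%R%:R <= 1 + 2 * logp w.
Proof.
elim: n => [|n IH]; first by rewrite big_ord0; have := logp_ge0 w; lra.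
rewrite big_ord_recr/=; case: (boolP (2 ^+ n < w)) => [nw|_]; last by rewrite addr0.
have lnw : n%:R * (1 / 2) <= logp w.
  have p0 : 0 < 2 ^+ n :> R by rewrite exprn_gt0.
  apply: (@le_trans _ _ (ln (2 ^+ n))).
    rewrite lnXn// -[ln 2 *+ n]mulr_natl; apply: ler_wpM2l => //.
    have : ln (1 + (- (1 / 2))) <= - (1 / 2) :> R by apply: le_ln1Dx; lra.
    rewrite (_ : 1 + - (1 / 2) = 2^-1); last by field.
    by rewrite lnV ?posrE//; lra.
  rewrite /logp le_max; apply/orP; right.
  by rewrite ler_ln ?posrE// ?ltW// (lt_trans p0).
have : \sum_(k < n) (2 ^+ k < w)%R%:R <= n%:R :> R.
  rewrite -[X in _ <= X%:R]card_ord -sum1_card natr_sum.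
  by apply: ler_sum => k _; case: (_ < _).
move: lnw; rewrite [X in _ -> _ -> _ + X <= _](_ : _ = 1)//; set S := \sum_(_ < _) _; lra.
Qed.

(** This is where one logarithm is gained: each nonzero term is at most [2 * Phi m t], since
    [t / 2 ^+ k <= t], and there are at most [1 + 2 * logp t] of them. *)
Lemma dyadic_Phi_sum m t : 0 <= t ->
  (\sum_(k <oo) (2 ^+ k.+1 * (if 2 ^+ k < t then Phi m (t / 2 ^+ k) else 0))%:E <=
   (4 * Phi m.+1 t)%:E)%E.
Proof.
move=> t0; have lt := logp_ge0 t.
apply: lime_le.
  apply: is_cvg_nneseries => k _ _; rewrite lee_fin mulr_ge0 ?exprn_ge0//.
  by case: ifP => // _; rewrite Phi_ge0// divr_ge0// exprn_ge0.
apply: nearW => n; rewrite sumEFin lee_fin big_mkord.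
apply: (@le_trans _ _ (\sum_(k < n) 2 * Phi m t * (2 ^+ k < t)%R%:R)).
  apply: ler_sum => k _; case: (boolP (2 ^+ k < t)) => kt; last by rewrite !mulr0.
  have p0 : 0 < 2 ^+ k :> R by rewrite exprn_gt0.
  rewrite mulr1 /Phi exprS -!mulrA ler_pM2l//.
  rewrite [leLHS](_ : _ = t * (1 + logp (t / 2 ^+ k)) ^+ m); last first.
    by field; rewrite gt_eqF.
  apply: ler_wpM2l => //; apply: lerXn2r; rewrite ?nnegrE ?addr_ge0 ?logp_ge0//.
  rewrite lerD2l; apply: le_logp; first by rewrite divr_gt0// (lt_trans p0).
  by rewrite ler_pdivrMr// ler_peMr// exprn_ege1// ler1n.
rewrite -mulr_sumr.
apply: (@le_trans _ _ (2 * Phi m t * (1 + 2 * logp t))).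
  by apply: ler_wpM2l; [rewrite mulr_ge0// Phi_ge0|exact: dyadic_count].
rewrite [leRHS](_ : _ = 2 * Phi m t * (2 * (1 + logp t))); last by rewrite /Phi exprSr; ring.
apply: ler_wpM2l; first by rewrite mulr_ge0// Phi_ge0.
lra.
Qed.

(** If [2 ^+ k * b < r <= 2 ^+ k.+1 * b], the single term of index [k] already dominates [r]. For
    infinite [y] this is used with arbitrarily large real [r]. *)
Lemma dyadic_layers (b : R) (y : \bar R) : 0 < b -> (b%:E < y)%E ->
  (y <= \sum_(k <oo) (2 ^+ k.+1 * b)%:E * (((2 ^+ k * b)%:E < y)%E%:R)%:E)%E.
Proof.
move=> b0 lby; set S := (\sum_(k <oo) _)%E.
have term_ge0 k : (0 <= (2 ^+ k.+1 * b)%:E * (((2 ^+ k * b)%:E < y)%E%:R : R)%:E)%E.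
  by rewrite mule_ge0// lee_fin// mulr_ge0// ?exprn_ge0// ltW.
have termS k : ((2 ^+ k.+1 * b)%:E * (((2 ^+ k * b)%:E < y)%E%:R : R)%:E <= S)%E.
  apply: le_trans (nneseries_lim_ge k.+1 (fun n _ _ => term_ge0 n)).
  by rewrite big_nat_recr//= leeDr// sume_ge0.
have rS (r : R) : b < r -> (r%:E <= y)%E -> (r%:E <= S)%E.
  move=> br ry; have exk : exists k, r <= 2 ^+ k * b.
    exists (Num.bound (r / b)); rewrite -ler_pdivrMr//.
    apply: ltW; apply: lt_le_trans (archi_boundP _) _; first by rewrite divr_ge0//; lra.
    by rewrite -natrX ler_nat ltnW// ltn_expl.
  case: (ex_minnP exk) => -[|k] rk kmin; first by move: rk; rewrite expr0 mul1r leNgt br.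
  have kr : 2 ^+ k * b < r by rewrite ltNge; apply/negP => /kmin; rewrite ltnn.
  apply: (le_trans _ (termS k)).
  by rewrite (lt_le_trans _ ry) ?lte_fin// mule1 lee_fin.
have [yoo|yoo] := eqVneq y +oo%E; last first.
  have yf : y \is a fin_num.
    by rewrite fin_numE yoo andbT; apply/eqP => yN; move: lby; rewrite yN.
  rewrite -(fineK yf); apply: rS; last by rewrite fineK.
  by rewrite -lte_fin fineK.
rewrite yoo leye_eq; apply/eqP/eqyP => r r0.
apply: (@le_trans _ _ (r + b)%:E); first by rewrite lee_fin lerDl ltW.
by apply: rS; [rewrite ltrDr|rewrite yoo leey].
Qed.

End weight.

Section iterated.
Context {R : realType} {d : nat}.
Local Notation X := (borel_space R d).
Local Notation mu := (borel_measure R d).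
Implicit Types (v : 'cV[R]_d) (vs : seq 'cV[R]_d) (f g h : X -> \bar R) (x : X).

Definition iter_maximal vs f : X -> \bar R := foldr flow_maximal f vs.

Lemma iter_maximal_ge0 vs f : (forall x, 0 <= f x)%E ->
  forall x, (0 <= iter_maximal vs f x)%E.
Proof. by move=> f0; elim: vs => //= v vs IH x; exact: flow_maximal_ge0. Qed.

Lemma measurable_iter_maximal vs f :
  measurable_fun [set: X] f -> (forall x, 0 <= f x)%E ->
  measurable_fun [set: X] (iter_maximal vs f).
Proof.
move=> mf f0; elim: vs => //= v vs IH; apply: measurable_flow_maximal => // x.
exact: iter_maximal_ge0.
Qed.

Lemma iter_maximal_le vs f h :
  measurable_fun [set: X] f -> measurable_fun [set: X] h ->
  (forall x, 0 <= f x)%E -> (forall x, f x <= h x)%E ->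
  forall x, (iter_maximal vs f x <= iter_maximal vs h x)%E.
Proof.
move=> mf mh f0 fh; have h0 x : (0 <= h x)%E := le_trans (f0 x) (fh x).
elim: vs => //= v vs IH x; apply: flow_maximal_le => //.
- exact: measurable_iter_maximal.
- exact: measurable_iter_maximal.
- exact: iter_maximal_ge0.
Qed.

Lemma iter_maximalD vs f (a : R) : 0 <= a ->
  measurable_fun [set: X] f -> (forall x, 0 <= f x)%E ->
  forall x, (iter_maximal vs (fun x => f x + a%:E) x <= iter_maximal vs f x + a%:E)%E.
Proof.
move=> a0 mf f0; elim: vs => //= v vs IH x.
have mT := measurable_iter_maximal vs _ mf f0.
have T0 := iter_maximal_ge0 vs _ f0.
apply: le_trans (flow_maximalD v _ _ x a0 mT T0); apply: flow_maximal_le => //.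
- apply: measurable_iter_maximal; first exact: emeasurable_funD.
  by move=> y; rewrite adde_ge0// lee_fin.
- exact: emeasurable_funD.
- by apply: iter_maximal_ge0 => y; rewrite adde_ge0// lee_fin.
Qed.

(** Termwise integration of [dyadic_layers], at the points where [g] exceeds [b]. *)
Lemma integral_large_le g (b : R) : 0 < b ->
  measurable_fun [set: X] g -> (forall x, 0 <= g x)%E ->
  (\int[mu]_x ((g \_ [set x | b%:E < g x]%E) x) <=
   \sum_(k <oo) (2 ^+ k.+1 * b)%:E * mu [set x | (2 ^+ k * b)%:E < g x]%E)%E.
Proof.
move=> b0 mg g0.
have mset (a : R) : measurable [set x : X | (a%:E < g x)%E].
  by rewrite -[X in measurable X]setTI; exact: emeasurable_fun_o_infty.
have c0 k : 0 <= 2 ^+ k.+1 * b by rewrite mulr_ge0 ?exprn_ge0// ltW.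
under eq_eseriesr => k _.
  rewrite -(setIT [set x | _]%E) -integral_indic//.
  rewrite -ge0_integralZl_EFin//; last first.
    by apply/measurable_EFinP; exact: measurable_indic.
  over.
rewrite -integral_nneseries//; last 2 first.
- move=> k; apply: measurable_funeM; apply/measurable_EFinP; exact: measurable_indic.
- by move=> k x _; rewrite mule_ge0// lee_fin.
apply: le_lower_integral => x _; first by apply: erestrict_ge0.
rewrite patchE; case: ifPn => [|_]; last first.
  by apply: nneseries_ge0 => k _ _; rewrite mule_ge0// lee_fin.
rewrite inE/= => bg; apply: le_trans (dyadic_layers b (g x) b0 bg) _.
rewrite le_eqVlt; apply/orP; left; apply/eqP; apply: eq_eseriesr => k _.
rewrite indicE; congr (_ * (nat_of_bool _)%:R%:E)%E.
by apply/idP/idP; rewrite inE.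
Qed.

Lemma measurable_Phi_fine m f (c : R) : measurable_fun [set: X] f ->
  measurable_fun [set: X] (fun x => (Phi m (fine (f x) / c))%:E).
Proof.
move=> mf; apply/measurable_EFinP; apply: (measurableT_comp (measurable_Phi m)).
by apply: measurable_funM => //; exact: measurableT_comp.
Qed.

(* [f] may take the value +oo on a null set, where [fine] is 0. *)
Lemma iter_maximal_weak_type m :
  exists2 C : R, 0 < C & forall vs, size vs = m.+1 -> forall f,
    measurable_fun [set: X] f -> (forall x, 0 <= f x)%E ->
    mu [set x | f x = +oo%E] = 0%E -> forall lambda, 0 < lambda ->
  (mu [set x | lambda%:E < iter_maximal vs f x]%E <=
   C%:E * \int[mu]_x (Phi m (fine (f x) / lambda))%:E)%E.
Proof.
elim: m => [|m [C C0 wT]].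
  exists 6 => // -[|v [|//]]//= _ f mf f0 foo l l0.
  apply: le_trans (flow_weak_type v f l l0 mf f0) _.
  rewrite le_eqVlt; apply/orP; left; apply/eqP.
  have l10 : 0 <= l^-1 by rewrite invr_ge0 ltW.
  rewrite EFinM -muleA; congr (_ * _)%E; rewrite -ge0_integralZl_EFin//.
  apply: ge0_ae_eq_integral => //.
  - exact: measurable_funeM.
  - exact: measurable_Phi_fine.
  - by move=> x _; rewrite mule_ge0// lee_fin.
  - by move=> x _; rewrite lee_fin Phi_ge0// divr_ge0 ?fine_ge0// ltW.
  exists [set x | f x = +oo%E]; split => //.
    by rewrite -[X in measurable X]setTI; exact: (mf measurableT _ (emeasurable_set1 +oo%E)).
  move=> x /= /not_implyP[_]; apply: contra_notP => fx.
  rewrite /Phi expr0 mulr1 mulrC EFinM fineK// ge0_fin_numE// ltey; exact/eqP.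
(* [6 * C] is [6 / b] times [b * C], the outer 4 comes from [dyadic_Phi_sum], and the rest from
   [Phi_scale] with factor 4, since [u] below is [4 * (fine f / l)]. *)
exists (6 * C * (4 * (4 * (1 + 4) ^+ m.+1))); first by rewrite !mulr_gt0.
move=> [|v vs]//= [sz] f mf f0 foo l l0; set g := iter_maximal vs f.
have mg : measurable_fun [set: X] g by exact: measurable_iter_maximal.
have g0 x : (0 <= g x)%E by exact: iter_maximal_ge0.
have mset h (a : R) : measurable_fun [set: X] h -> measurable [set x : X | (a%:E < h x)%E].
  by move=> mh; rewrite -[X in measurable X]setTI; exact: emeasurable_fun_o_infty.
have mpatch h (a : R) : measurable_fun [set: X] h ->
    measurable_fun [set: X] (h \_ [set x | (a%:E < h x)%E]).
  by move=> mh; apply/(measurable_restrictT _ _).1; [exact: mset|exact: measurable_funTS].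
have patch_ge0 h (a : R) : (forall x, 0 <= h x)%E ->
    forall x, (0 <= (h \_ [set x | a%:E < h x]) x)%E.
  by move=> h0 x; apply: erestrict_ge0.
have le_patch h (a : R) : 0 <= a -> (forall x, 0 <= h x)%E ->
    forall x, (h x <= (h \_ [set x | a%:E < h x]) x + a%:E)%E.
  move=> a0 h0 x; rewrite patchE; case: ifPn => [_|]; first by rewrite leeDl// lee_fin.
  by rewrite notin_setE/= add0e => /negP; rewrite -leNgt.
(* Two truncations, each halving the level: [g] is cut at [b] for the outer operator, and [f] at
   [2 ^+ k * c], half of [2 ^+ k * b], for the inner ones. *)
pose b := l / 2; have b0 : 0 < b by rewrite divr_gt0.
pose c := l / 4; have c0 : 0 < c by rewrite divr_gt0.
pose g1 := g \_ [set x | (b%:E < g x)%E].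
have mg1 : measurable_fun [set: X] g1 by exact: mpatch.
have g10 x : (0 <= g1 x)%E by exact: patch_ge0.
have step1 : (mu [set x | l%:E < flow_maximal v g x]%E <= (6 / b)%:E * \int[mu]_x g1 x)%E.
  apply: le_trans (flow_weak_type v g1 b b0 mg1 g10); apply: le_measure.
  - by rewrite inE; apply: mset; exact: measurable_flow_maximal.
  - by rewrite inE; apply: mset; exact: measurable_flow_maximal.
  move=> x /= lx; rewrite -(@lteD2rE _ b%:E)// -EFinD (_ : b + b = l); last first.
    by rewrite /b; field.
  apply: (lt_le_trans lx); apply: le_trans (flow_maximalD v g1 b x (ltW b0) mg1 g10).
  apply: flow_maximal_le => //; first exact: emeasurable_funD.
  by move=> y; apply: le_patch => //; exact: ltW.
pose u x := fine (f x) / c.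
have u0 x : 0 <= u x by rewrite divr_ge0 ?fine_ge0// ltW.
(* The integrand of the induction hypothesis for the part of [f] above [2 ^+ k * c], written in
   terms of [u]. *)
pose P k x : R := if 2 ^+ k < u x then Phi m (u x / 2 ^+ k) else 0.
have P0 k x : 0 <= P k x.
  by rewrite /P; case: ifP => // _; rewrite Phi_ge0// divr_ge0// exprn_ge0.
have mP k : measurable_fun [set: X] (fun x => (P k x)%:E).
  apply/measurable_EFinP.
  have mu_ : measurable_fun [set: X] u.
    by apply: measurable_funM => //; exact: measurableT_comp.
  apply: measurable_fun_ifT => //; first exact: measurable_fun_ltr.
  apply: (measurableT_comp (measurable_Phi m)); exact: measurable_funM.
(* Since [f <= fk + a], the inequality [g > 2 a] forces the iterated maximal function of [fk] to
   exceed [a]. *)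
have step2 k : (mu [set x | (2 ^+ k * b)%:E < g x]%E <= C%:E * \int[mu]_x (P k x)%:E)%E.
  pose a := 2 ^+ k * c; have a0 : 0 < a by rewrite mulr_gt0 ?exprn_gt0.
  pose fk := f \_ [set x | (a%:E < f x)%E].
  have mfk : measurable_fun [set: X] fk by exact: mpatch.
  have fk0 x : (0 <= fk x)%E by exact: patch_ge0.
  have fkoo : mu [set x | fk x = +oo%E] = 0%E.
    rewrite -foo; congr (mu _); apply/seteqP; split => x /=; rewrite /fk patchE.
      by case: ifP.
    by move=> fx; rewrite ifT// inE/= fx ltry.
  have -> : (\int[mu]_x (P k x)%:E = \int[mu]_x (Phi m (fine (fk x) / a))%:E)%E.
    apply: eq_integral => x _; congr EFin; rewrite /P /fk patchE.
    rewrite /u ltr_pdivlMr// -/a.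
    (* At an infinite value of [f], [fine] returns 0 and both integrands vanish. *)
    have [fin|] := boolP (f x \is a fin_num); last first.
      rewrite ge0_fin_numE// ltey negbK => /eqP ->; rewrite /= ltNge (ltW a0)/=.
      by case: ifP => _; rewrite /Phi mul0r mul0r.
    have -> : (x \in [set x | (a%:E < f x)%E]) = (a < fine (f x)).
      by rewrite -lte_fin fineK//; apply/idP/idP; rewrite inE.
    case: ifP => _; last by rewrite /Phi mul0r mul0r.
    by congr Phi; rewrite /a; field; rewrite !gt_eqF ?exprn_gt0.
  apply: le_trans (wT vs sz fk mfk fk0 fkoo a a0); apply: le_measure.
  - by rewrite inE; exact: mset.
  - by rewrite inE; apply: mset; exact: measurable_iter_maximal.
  move=> x /= gx; rewrite -(@lteD2rE _ a%:E)// -EFinD (_ : a + a = 2 ^+ k * b); last first.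
    by rewrite /a /b /c; field.
  apply: (lt_le_trans gx); apply: le_trans (iter_maximalD vs fk a (ltW a0) mfk fk0 x).
  apply: iter_maximal_le => //; first exact: emeasurable_funD.
  by move=> y; apply: le_patch => //; exact: ltW.
apply: (le_trans step1).
apply: (@le_trans _ _ ((6 / b)%:E *
    ((b * C)%:E * \int[mu]_x (\sum_(k <oo) (2 ^+ k.+1 * P k x)%:E)))%E).
  apply: lee_wpmul2l; first by rewrite lee_fin divr_ge0// ltW.
  apply: le_trans (integral_large_le g b b0 mg g0) _.
  have tk0 k x : (0 <= (2 ^+ k.+1 * P k x)%:E)%E by rewrite lee_fin mulr_ge0 ?exprn_ge0.
  rewrite integral_nneseries//; last first.
    by move=> k; under eq_fun do rewrite EFinM; exact: measurable_funeM.
  rewrite -nneseriesZl//; last by move=> k _; exact: integral_ge0.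
  apply: lee_nneseries => k _.
    by rewrite mule_ge0// lee_fin mulr_ge0 ?exprn_ge0// ltW.
  apply: (@le_trans _ _ ((2 ^+ k.+1 * b)%:E * (C%:E * \int[mu]_x (P k x)%:E))%E).
    by apply: lee_wpmul2l; [rewrite lee_fin mulr_ge0 ?exprn_ge0// ltW|exact: step2].
  under [in leRHS]eq_integral do rewrite EFinM.
  rewrite ge0_integralZl_EFin ?exprn_ge0//; last by move=> x _; rewrite lee_fin.
  rewrite !muleA -!EFinM le_eqVlt; apply/orP; left; apply/eqP; congr (_%:E * _)%E; ring.
have Q0 x : 0 <= fine (f x) / l by rewrite divr_ge0 ?fine_ge0// ltW.
apply: (@le_trans _ _ ((6 / b)%:E * ((b * C)%:E * \int[mu]_x
   ((4 * (4 * (1 + 4) ^+ m.+1))%:E * (Phi m.+1 (fine (f x) / l))%:E)))%E).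
  apply: lee_wpmul2l; first by rewrite lee_fin divr_ge0// ltW.
  apply: lee_wpmul2l; first by rewrite lee_fin mulr_ge0// ltW.
  apply: le_lower_integral => x _.
    by apply: nneseries_ge0 => k _ _; rewrite lee_fin mulr_ge0 ?exprn_ge0.
  apply: (le_trans (dyadic_Phi_sum m (u x) (u0 x))).
  rewrite -EFinM lee_fin -!mulrA ler_pM2l// mulrA.
  have -> : u x = 4 * (fine (f x) / l) by rewrite /u /c; field; rewrite gt_eqF.
  by apply: Phi_scale => //; rewrite ler1n.
rewrite ge0_integralZl_EFin//; last first.
  exact: measurable_Phi_fine.
  by move=> x _; rewrite lee_fin Phi_ge0.
rewrite !muleA -!EFinM le_eqVlt; apply/orP; left; apply/eqP; congr (_%:E * _)%E.
by field; rewrite gt_eqF.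
Qed.

End iterated.

(** * Domination of [maximal_function] *)

(** Cramer's rule for the system [B *m c = col j Q], solved by the adjugate. *)
Lemma cramer_col_ratio (F : fieldType) (r n : nat) (Q : 'M[F]_(r, n))
    (J : 'I_r -> 'I_n) (j : 'I_n) (B := colsub J Q) : \det B != 0 ->
  col j Q = \sum_i
    (\det (colsub (fun k => if k == i then j else J k) Q) / \det B) *: col (J i) Q.
Proof.
move=> B0; pose c := (\det B)^-1 *: (\adj B *m col j Q).
have cE i : c i 0 = \det (colsub (fun k => if k == i then j else J k) Q) / \det B.
  rewrite /c mxE mulrC; congr (_ / _).
  (* Only column [i] has been replaced, so the cofactors along it are those of [B]. *)
  rewrite (expand_det_col _ i) mxE; apply: eq_bigr => k _.
  rewrite !mxE eqxx mulrC; congr (_ * _); rewrite /cofactor; congr (_ * \det _).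
  by apply/matrixP => a b; rewrite !mxE eq_sym (negbTE (neq_lift _ _)).
have : col j Q = B *m c.
  by rewrite /c -scalemxAr mulmxA mul_mx_adj mul_scalar_mx scalerA mulVf// scale1r.
move=> ->; apply/colP => k; rewrite summxE !mxE; apply: eq_bigr => i _.
by rewrite cE !mxE mulrC.
Qed.

Lemma dominating_columns (R : realType) (d n : nat) (A : 'M[R]_(d, n))
    (rho : 'I_n -> R) : (forall j, 0 < rho j) ->
  exists (J : {ffun 'I_(\rank A) -> 'I_n}) (c : 'I_n -> 'I_(\rank A) -> R),
  forall j, (forall i, `|c j i| * rho j <= rho (J i)) /\
    col j A = \sum_i c j i *: col (J i) A.
Proof.
move=> rho0; set Q := row_base A.
pose W (J : {ffun 'I_(\rank A) -> 'I_n}) : R := `|\det (colsub J Q)| * \prod_i rho (J i).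
have prod_gt0 (J : {ffun 'I_(\rank A) -> 'I_n}) : 0 < \prod_i rho (J i).
  by apply: prodr_gt0.
(* Some choice of columns of [Q] is invertible, so the maximum of [W] is positive and the maximizing
   minor is nonzero. *)
have Qfull : row_full Q^T by rewrite /row_full mxrank_tr; exact: row_base_free.
pose J0 := [ffun i => fullrankfun Qfull i].
have W0 : 0 < W J0.
  rewrite mulr_gt0// normr_gt0.
  have := fullrowsub_unit Qfull; rewrite unitmxE unitfE -det_tr.
  by congr (\det _ != 0); apply/matrixP => a b; rewrite 3!mxE [in RHS]mxE [J0 b]ffunE.
pose J := [arg max_(J > J0) W J]%O.
have Jmax J' : W J' <= W J.
  by rewrite /J; case: arg_maxP => // J1 _; apply.
have detJ : \det (colsub J Q) != 0.
  by have := lt_le_trans W0 (Jmax J0); rewrite /W pmulr_lgt0// normr_gt0.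
exists J, (fun j i =>
  \det (colsub (fun k => if k == i then j else J k) Q) / \det (colsub J Q)) => j.
split=> [i|].
  (* The maximizer is compared with the choice that has [j] in place of [J i]: the two products
     differ in one factor, and the ratio of determinants is the Cramer coefficient. *)
  have := Jmax [ffun k => if k == i then j else J k].
  rewrite /W !(bigD1 (P := predT) i)//= ffunE eqxx.
  set p := \prod_(k | k != i) rho (J k).
  rewrite [\prod_(k | k != i) _](_ : _ = p); last first.
    by apply: eq_bigr => k ki; rewrite ffunE (negbTE ki).
  have p0 : 0 < p by apply: prodr_gt0.
  rewrite !mulrA ler_pM2r// normf_div => h.
  rewrite mulrAC ler_pdivrMr ?normr_gt0// [leRHS]mulrC.
  apply: le_trans h; rewrite le_eqVlt; apply/orP; left; apply/eqP.
  by congr (`|\det _| * _); apply/matrixP => a b; rewrite !mxE ffunE.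
(* Relations among the columns of [Q] carry over to [A] through the factorization. *)
have colA k : col k A = col_base A *m col k Q by rewrite !colE mulmxA mulmx_base.
rewrite colA (@cramer_col_ratio _ _ _ _ J)// mulmx_sumr; apply: eq_bigr => i _.
by rewrite -scalemxAr -colA.
Qed.

Section iterated_average.
Context {R : realType} {d : nat} {I : Type}.
Local Notation X := (borel_space R d).
Local Notation leb := (@lebesgue_measure R).
Variables (v : I -> 'cV[R]_d) (rho : I -> R).
Hypothesis rho0 : forall i, 0 < rho i.
Implicit Types (s : seq I) (f : X -> \bar R).

Definition iter_avg s f : X -> \bar R := foldr (fun i => flow_avg (v i) (rho i)) f s.

Lemma iter_avg_ge0 s f : (forall x, 0 <= f x)%E -> forall x, (0 <= iter_avg s f x)%E.
Proof. by move=> f0; elim: s => //= i s IH x; exact: flow_avg_ge0. Qed.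

Lemma measurable_iter_avg s f :
  measurable_fun [set: X] f -> (forall x, 0 <= f x)%E ->
  measurable_fun [set: X] (iter_avg s f).
Proof.
move=> mf f0; elim: s => //= i s IH; apply: measurable_flow_avg => //.
exact: iter_avg_ge0.
Qed.

(** The interval of radius [a] about [c] lies in the one of radius [(1 + K) * a] about 0. *)
Lemma flow_avg_shift_le (w : 'cV[R]_d) (a c K : R) f (x : X) : 0 < a -> 0 <= K ->
  `|c| <= K * a -> measurable_fun [set: X] f -> (forall x, 0 <= f x)%E ->
  (flow_avg w a f (x + c *: w)%R <= (1 + K)%:E * flow_avg w ((1 + K) * a) f x)%E.
Proof.
move=> a0 K0 cK mf f0; rewrite /flow_avg.
have a1 : 0 < (1 + K) * a by rewrite mulr_gt0//; lra.
rewrite muleA -EFinM (_ : (1 + K) * (2 * ((1 + K) * a))^-1 = (2 * a)^-1); last first.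
  by field; apply/andP; split; rewrite gt_eqF//; lra.
apply: lee_wpmul2l; first by rewrite lee_fin invr_ge0 mulr_ge0// ltW.
have mline := measurable_flow_line w f x mf.
under eq_integral do rewrite -addrA -scalerDl.
rewrite (_ : `](- a)%R, a[%classic = (fun t => (c + t)%R) @^-1` `]c - a, c + a[%classic).
  rewrite (@ge0_integral_shift R (fun s : R => f (x + s *: w)%R))//.
  apply: ge0_subset_integral => //; try exact: measurable_itv.
    exact: measurable_funTS.
  by move=> s /=; rewrite !in_itv/=; move: cK; rewrite ler_norml; lra.
by apply/seteqP; split => s /=; rewrite !in_itv/=; lra.
Qed.

(** Each direction costs a factor [1 + K] to recentre the average and a factor 2 to pass to the
    radii of [flow_maximal]. *)
Lemma iter_avg_shift_le s (c : I -> R) (K : R) f x : 0 <= K ->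
  (forall i, `|c i| <= K * rho i) ->
  measurable_fun [set: X] f -> (forall x, 0 <= f x)%E ->
  (iter_avg s f (x + \sum_(i <- s) c i *: v i)%R <=
   ((2 * (1 + K)) ^+ size s)%:E * iter_maximal (map v s) f x)%E.
Proof.
move=> K0 cK mf f0; elim: s x => [|i s IH] x /=.
  by rewrite big_nil addr0 expr0 mul1e.
have K1 : 0 < 1 + K by lra.
have C0 : 0 <= (2 * (1 + K)) ^+ size s by rewrite exprn_ge0// mulr_ge0// ltW.
have mT := measurable_iter_maximal (map v s) _ mf f0.
have T0 := iter_maximal_ge0 (map v s) _ f0.
rewrite big_cons addrA.
apply: (@le_trans _ _ (((2 * (1 + K)) ^+ size s)%:E *
   flow_avg (v i) (rho i) (iter_maximal (map v s) f) (x + c i *: v i)%R)%E).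
  rewrite /flow_avg muleCA -[in leRHS]ge0_integralZl_EFin//; last first.
    by apply: measurable_funTS; exact: measurable_flow_line.
  apply: lee_wpmul2l; first by rewrite lee_fin invr_ge0 mulr_ge0// ltW.
  apply: le_lower_integral => t _; first exact: iter_avg_ge0.
  (* Translations commute, so the induction hypothesis applies at the point
     [x + c i *: v i + t *: v i]. *)
  by rewrite [X in iter_avg _ _ X]addrAC; exact: IH.
rewrite exprSr EFinM -muleA; apply: lee_wpmul2l; first by rewrite lee_fin.
apply: le_trans (flow_avg_shift_le _ _ _ _ _ _ (rho0 i) K0 (cK i) mT T0) _.
rewrite [2 * _]mulrC EFinM -muleA; apply: lee_wpmul2l; first by rewrite lee_fin ltW.
by apply: flow_avg_le_maximal => //; exact: mulr_gt0.
Qed.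

End iterated_average.

Section box_average.
Context {R : realType} {d n : nat} (A : 'M[R]_(d, n)) (a : 'cV[R]_n).
Hypothesis a0 : forall j, 0 < a j 0.
Local Notation X := (borel_space R d).
Local Notation Y := (borel_space R n).
Local Notation mu := (borel_measure R n).
Local Notation leb := (@lebesgue_measure R).
Implicit Types (f : X -> \bar R) (x : X).

Lemma measurable_affine_flow x (w : 'cV[R]_d) :
  measurable_fun [set: Y * R] (fun z => (x + A *m z.1 + z.2 *: w)%R : X).
Proof.
apply: measurable_to_borel => i; under eq_fun do rewrite !mxE.
apply: measurable_funD; last exact: measurable_funM.
apply: measurable_funD => //; apply: measurable_sum => j.
apply: measurable_funM => //.
exact: (measurableT_comp (measurable_coord R n j) measurable_fst).
Qed.

(* Translating t by s times the j-th basis vector moves the box of radii k a into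
   that of radii (k + 1) a as long as |s| < a j; average over such s. *)
Lemma box_integral_le_avg (k : R) (j : 'I_n) f x :
  measurable_fun [set: X] f -> (forall x, 0 <= f x)%E ->
  (\int[mu]_(t in symmetric_interval (k *: a)%R) f (x + A *m t)%R <=
   \int[mu]_(t in symmetric_interval ((k + 1) *: a)%R)
      flow_avg (col j A) (a j 0)%R f (x + A *m t)%R)%E.
Proof.
move=> mf f0; set B := symmetric_interval _; set B' := symmetric_interval _.
have mB : measurable (B : set Y) by exact: measurable_box.
have mB' : measurable (B' : set Y) by exact: measurable_box.
set L := (\int[mu]_(t in B) _)%E.
have mfA : measurable_fun [set: Y] (fun t : Y => f (x + A *m t)%R).
  exact: (measurableT_comp mf (measurable_affine R d n A x)).
have aj0 := a0 j.
pose D : set R := `](- a j 0), (a j 0)[%classic.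
have mD : measurable D by exact: measurable_itv.
have lebD : leb D = (2 * a j 0)%:E.
  by rewrite /D lebesgue_measure_itv/= lte_fin ifT ?gtrN// -EFinB; congr EFin; lra.
pose Phi (z : Y * R) := ((fun z : Y * R => f (x + A *m z.1 + z.2 *: col j A)%R) \_
  (B' `*` [set: R])) z.
have mPhi : measurable_fun [set: Y * R] Phi.
  apply/(measurable_restrictT _ _).1; first exact: measurableX.
  apply: measurable_funTS.
  exact: (measurableT_comp mf (measurable_affine_flow x (col j A))).
have Phi0 z : (0 <= Phi z)%E by apply: erestrict_ge0.
have LPhi s : D s -> (L <= \int[mu]_t Phi (t, s))%E.
  rewrite /D/= in_itv/= => sD.
  rewrite /L integral_mkcond -(ge0_integral_translate _ _ _ (s *: delta_mx j 0)).
  - apply: le_lower_integral => t _; first exact: erestrict_ge0.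
    rewrite /Phi !patchE in_setX in_setT andbT /=.
    case: ifPn => [|_]; last by case: ifP.
    rewrite inE => tB; rewrite ifT.
      by rewrite mulmxDr -scalemxAr -colE addrA.
    rewrite inE => i; have := tB i; have := a0 i; rewrite !mxE/= andbT.
    by case: eqP => [->|_]; rewrite ?mulr1 ?mulr0 ?addr0; lra.
  - by apply/(measurable_restrictT _ _).1 => //; exact: measurable_funTS.
  - by move=> t; exact: erestrict_ge0.
rewrite -(@lee_pmul2r _ (2 * a j 0)%:E)//; last by rewrite lte_fin mulr_gt0.
rewrite -{1}lebD -(integral_cst leb mD).
apply: (@le_trans _ _ (\int[leb]_(s in D) \int[mu]_t Phi (t, s))%E).
  apply: le_lower_integral => s sD; last exact: LPhi.
  exact: integral_ge0.
rewrite -(tonelli_restrict _ mu Phi D mD mPhi Phi0).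
rewrite muleC -ge0_integralZl_EFin//; last 3 first.
- by move=> t _; exact: flow_avg_ge0.
- apply: measurable_funTS.
  apply: (measurableT_comp _ (measurable_affine R d n A x)).
  exact: measurable_flow_avg.
- by rewrite mulr_ge0// ltW.
rewrite [leRHS]integral_mkcond; apply: le_lower_integral => t _.
  exact: integral_ge0.
rewrite patchE; case: ifPn => tB; last first.
  by rewrite integral0_eq// => s _; rewrite /Phi patchE in_setX (negbTE tB).
rewrite /flow_avg muleA -EFinM divff ?mul1e ?gt_eqF ?mulr_gt0//.
rewrite le_eqVlt; apply/orP; left; apply/eqP; apply: eq_integral => s _.
by rewrite /Phi patchE in_setX tB in_setT.
Qed.

(** Each index of [s] adds one average and enlarges the radii of the box by [a]. *)
Lemma box_integral_le_iter_avg (s : seq 'I_n) f x :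
  measurable_fun [set: X] f -> (forall x, 0 <= f x)%E ->
  (\int[mu]_(t in symmetric_interval a) f (x + A *m t)%R <=
   \int[mu]_(t in symmetric_interval ((1 + (size s)%:R) *: a)%R)
      iter_avg (fun j => col j A) (fun j => (a j 0)%R) s f (x + A *m t)%R)%E.
Proof.
move=> mf f0; elim: s => [|j s IH]; first by rewrite addr0 !scale1r.
apply: (le_trans IH); rewrite /= -natr1 addrA.
apply: box_integral_le_avg; first exact: measurable_iter_avg.
exact: iter_avg_ge0.
Qed.

Lemma borel_measure_box_scale (k : R) : 0 < k ->
  (mu (symmetric_interval (k *: a)%R) <= (k ^+ n)%:E * mu (symmetric_interval a))%E.
Proof.
move=> k0; apply: le_trans (lebesgue_outer_affine (symmetric_interval a) k 0 k0).
apply: le_lebesgue_outer => t tB; exists (k^-1 *: t); last first.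
  by rewrite addr0 scalerA divff ?scale1r// gt_eqF.
move=> i; have := tB i; rewrite !mxE => /andP[h1 h2].
by rewrite ler_pdivlMl// ler_pdivrMl// mulrN h1 h2.
Qed.

End box_average.

(** * Borel majorants *)

Section borel_hull.
Context {R : realType} {d : nat}.
Local Notation X := (borel_space R d).
Local Notation outer := (lebesgue_outer R d).

Lemma measurable_box_union (D : set ('cV[R]_d * 'cV[R]_d)) : countable D ->
  measurable (\bigcup_(p in D) box p.1 p.2 : set X).
Proof.
move=> /countable_injP[h hI].
have -> : \bigcup_(p in D) box p.1 p.2 =
    \bigcup_n \bigcup_(p in D `&` [set p | h p = n]) box p.1 p.2.
  apply/seteqP; split => [x [p Dp px]|x [n _ [p [Dp _] px]]]; last by exists p.
  by exists (h p) => //; exists p.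
apply: bigcup_measurable => n _.
have [->|/set0P[p [Dp hp]]] := eqVneq (D `&` [set p | h p = n]) set0.
  by rewrite bigcup_set0.
rewrite (_ : D `&` _ = [set p]) ?bigcup_set1; first exact: measurable_box.
apply/seteqP; split => [q [Dq hq]|_ ->//].
by apply: hI; rewrite ?inE// hq hp.
Qed.

(** [H] is an intersection of countable box unions of nearly optimal measure, so it has the measure
    of [E]. The Caratheodory condition for [E], tested on [H], and finiteness then give the null
    difference. *)
Lemma borel_hull_finite (E : set 'cV[R]_d) : outer.-caratheodory E ->
  (outer E < +oo)%E ->
  exists H : set X, [/\ measurable H, E `<=` H & outer (H `\` E) = 0%E].
Proof.
move=> mE Eoo; have Efin : outer E \is a fin_num.
  by rewrite ge0_fin_numE// lebesgue_outer_ge0.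
have cover k : exists U : set X, [/\ measurable U, E `<=` U &
    (outer U <= outer E + (k.+1%:R^-1)%:E)%E].
  have k0 : 0 < k.+1%:R^-1 :> R by rewrite invr_gt0 ltr0n.
  have [_ [D [cD ED] <-] Dlt] := lb_ereal_inf_adherent k0 Efin.
  exists (\bigcup_(p in D) box p.1 p.2); split => //.
    exact: measurable_box_union.
  by apply: le_trans (ltW Dlt); apply: ereal_inf_lbound; exists D => //; split.
have [U UP] := choice cover.
have EH : E `<=` \bigcap_k U k by move=> x Ex k _; have [_ + _] := UP k; apply.
exists (\bigcap_k U k); split => //.
  by apply: bigcapT_measurable => k; have [] := UP k.
have HE : (outer (\bigcap_k U k) <= outer E)%E.
  apply/lee_addgt0Pr => e e0.
  have [k _ ke] : exists2 k : nat, True & k.+1%:R^-1 <= e.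
    exists (Num.bound e^-1) => //; rewrite invf_ple ?posrE//.
    have : e^-1 < (Num.bound e^-1)%:R by apply: archi_boundP; rewrite invr_ge0 ltW.
    by rewrite -natr1; lra.
  have [_ _ Uk] := UP k.
  apply: (@le_trans _ _ (outer (U k))); first by apply: le_lebesgue_outer; exact: bigcap_inf.
  by apply: (le_trans Uk); rewrite leeD2l// lee_fin.
have := mE (\bigcap_k U k); rewrite (setIidr EH) -setDE => HEq.
apply/eqP; rewrite eq_le lebesgue_outer_ge0 andbT.
by rewrite HEq -[leRHS]adde0 leeD2lE in HE.
Qed.

Lemma borel_hull (E : set 'cV[R]_d) : outer.-caratheodory E ->
  exists H : set X, [/\ measurable H, E `<=` H & outer (H `\` E) = 0%E].
Proof.
move=> mE; have [F FT FB] := @sigma_finiteT _ X R (borel_measure R d).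
have hullk k : exists H : set X, [/\ measurable H, E `&` F k `<=` H &
    outer (H `\` (E `&` F k)) = 0%E].
  have [mF Foo] := FB k.
  apply: borel_hull_finite.
    by apply: caratheodory_measurable_setI => //; exact: borel_caratheodory.
  by apply: le_lt_trans Foo; apply: le_lebesgue_outer; exact: subIsetr.
have [H HP] := choice hullk.
exists (\bigcup_k H k); split.
- by apply: bigcup_measurable => k _; have [] := HP k.
- move=> x Ex; have : [set: X] x by [].
  by rewrite FT => -[k _ Fx]; exists k => //; have [_ + _] := HP k; apply.
apply/eqP; rewrite eq_le lebesgue_outer_ge0 andbT.
apply: (@le_trans _ _ (\sum_(k <oo) outer (H k `\` (E `&` F k)))%E).
  apply: le_trans (lebesgue_outer_sigma_subadditive _).
  apply: le_lebesgue_outer => x [[k _ Hx] nEx]; exists k => //; split => //.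
  by move=> [].
by rewrite eseries0// => k _ _; have [] := HP k.
Qed.

(** Each superlevel set of [|f|] at a rational height is replaced by a Borel hull, and [g] is the
    supremum of the heights whose hull contains the point. [Z] collects the null differences. *)
Lemma borel_majorant (f : 'cV[R]_d -> R) :
  measurable_fun [set: lebesgue_space R d] (f : lebesgue_space R d -> R) ->
  exists (g : X -> \bar R) (Z : set 'cV[R]_d),
    [/\ measurable_fun [set: X] g, forall x, (`|f x|%:E <= g x)%E,
        outer.-caratheodory Z, outer Z = 0%E &
        forall x, ~ Z x -> g x = `|f x|%:E].
Proof.
move=> mf; pose q k : R := if unpickle k is Some r then ratr (r : rat) else 0.
pose E k : set 'cV[R]_d := [set x | q k <= `|f x|].
have mE k : outer.-caratheodory (E k).
  have mnf : measurable_fun [set: lebesgue_space R d]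
      (fun x : lebesgue_space R d => `|f x|) by exact: measurableT_comp.
  have := mnf measurableT `[q k, +oo[%classic (measurable_itv _).
  rewrite setTI; congr (outer.-caratheodory _).
  by apply/seteqP; split => x /=; rewrite in_itv/= andbT.
have [H HP] := choice (fun k => borel_hull _ (mE k)).
pose t k (x : X) : \bar R := (q k * \1_(H k) x)%:E.
(* The levels q k run through all rationals; the negative ones are harmless. *)
pose g (x : X) := esups (t ^~ x) 0.
have fg x : (`|f x|%:E <= g x)%E.
  rewrite leNgt; apply/negP => gf.
  (* The level 0 makes [g x] nonnegative, hence finite when it is below [|f x|]; a rational strictly
     between the two gives the contradiction. *)
  have g0 : (0 <= g x)%E.
    apply: ereal_sup_ubound; exists (pickle (0 : rat)) => //.
    by rewrite /t /q pickleK rmorph0 mul0r.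
  have gfin : g x \is a fin_num.
    by rewrite ge0_fin_numE//; apply: lt_trans gf _; rewrite ltry.
  move: gf; rewrite -(fineK gfin) lte_fin => /rat_in_itvoo[r].
  rewrite in_itv/= => /andP[gr rf].
  have : ((ratr r : R)%:E <= g x)%E.
    apply: ereal_sup_ubound; exists (pickle r) => //.
    rewrite /t /q pickleK indicE mem_set ?mulr1//.
    by have [_ + _] := HP (pickle r); apply; rewrite /E/= /q pickleK ltW.
  by rewrite -(fineK gfin) lee_fin leNgt gr.
exists g, (\bigcup_k (H k `\` E k)); split.
- apply: measurable_fun_esups => k; apply/measurable_EFinP.
  by apply: measurable_funM => //; apply: measurable_indic; have [] := HP k.
- exact: fg.
- apply: caratheodory_measurable_bigcup => k; apply: caratheodory_measurable_setD => //.
  by apply: borel_caratheodory; have [] := HP k.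
- apply/eqP; rewrite eq_le lebesgue_outer_ge0 andbT.
  apply: le_trans (lebesgue_outer_sigma_subadditive _) _.
  by rewrite eseries0// => k _ _; have [] := HP k.
- move=> x nZ; apply/eqP; rewrite eq_le; apply/andP; split.
    apply: ge_ereal_sup => _ [k _ <-]; rewrite /t lee_fin indicE.
    case: (boolP (x \in H k)) => [|_]; last by rewrite mulr0.
    rewrite inE mulr1 => Hx; apply: contrapT => nEx; apply: nZ.
    by exists k.
  exact: fg.
Qed.

End borel_hull.

(** [J] varies with the box, hence with [x], but takes finitely many values, and [K] depends only on
    [A]. *)
Lemma maximal_function_iter_maximal (R : realType) (d n : nat) (A : 'M[R]_(d, n)) :
  exists2 K : R, 1 <= K &
  forall (f : 'cV[R]_d -> R) (g : borel_space R d -> \bar R),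
    measurable_fun [set: borel_space R d] g -> (forall x, `|f x|%:E <= g x)%E ->
  forall x lambda, 0 < lambda -> (lambda%:E < maximal_function A f x)%E ->
  exists J : {ffun 'I_(\rank A) -> 'I_n},
    ((lambda / K)%:E <
       iter_maximal [seq col (J i) A | i <- enum 'I_(\rank A)] g x)%E.
Proof.
(* On the enlarged box [|t j| <= (1 + r) * a j], so the coefficient of column [J i] in [A *m t], a
   sum of [n] terms, is at most [K0 * a (J i)]. [Ct] then comes from [iter_avg_shift_le], and [Cn]
   from dilating the box by [1 + r]. *)
set r := \rank A; pose K0 : R := n%:R * (1 + r%:R).
have K00 : 0 <= K0 by rewrite mulr_ge0.
pose Ct := (2 * (1 + K0)) ^+ r; pose Cn : R := (1 + r%:R) ^+ n.
have Ct1 : 1 <= Ct by apply: exprn_ege1; lra.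
have Cn1 : 1 <= Cn by apply: exprn_ege1; rewrite lerDl.
have CtCn1 : 1 <= Ct * Cn by rewrite -[leLHS]mulr1 ler_pM.
exists (Ct * Cn) => // f g mg fg x l l0 /ereal_sup_gt[_ [a a0 <-]].
have g0 y : (0 <= g y)%E by apply: le_trans (fg y); rewrite lee_fin.
have [J [c Jc]] := dominating_columns _ _ _ A (fun j => a j 0) a0.
set V := lebesgue_cV R n (symmetric_interval a).
have Vfin : V \is a fin_num.
  by rewrite ge0_fin_numE ?measure_ge0//; exact: lebesgue_outer_box_lty.
have V0 : 0 <= fine V by rewrite fine_ge0// measure_ge0.
move=> lV; exists J.
set T := iter_maximal _ g x.
have T0 : (0 <= T)%E by exact: iter_maximal_ge0.
have intV : (\int[lebesgue_cV R n]_(t in symmetric_interval a) `|f (x + A *m t)%R|%:E <=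
    (Ct * Cn)%:E * T * V)%E.
  apply: (@le_trans _ _
    (\int[borel_measure R n]_(t in symmetric_interval a) g (x + A *m t)%R)%E).
    apply: (@le_trans _ _
      (\int[lebesgue_cV R n]_(t in symmetric_interval a) g (x + A *m t)%R)%E).
      by apply: le_lower_integral => t _; [rewrite lee_fin|exact: fg].
    rewrite integral_mkcond [leRHS]integral_mkcond ge0_integral_borel//.
      apply/(measurable_restrictT _ _).1; first exact: measurable_box.
      by apply: measurable_funTS; exact: (measurableT_comp mg (measurable_affine R d n A x)).
    by move=> t; exact: erestrict_ge0.
  apply: le_trans (box_integral_le_iter_avg A a a0 [seq J i | i <- enum 'I_r] g x mg g0) _.
  rewrite size_map size_enum_ord /iter_avg foldr_map.
  set B := symmetric_interval _.
  have mB : measurable (B : set (borel_space R n)) by exact: measurable_box.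
  apply: (@le_trans _ _ (\int[borel_measure R n]_(t in B) (Ct%:E * T))%E).
    apply: le_lower_integral => t tB.
      by apply: iter_avg_ge0.
    have tB' j : `|t j 0| <= (1 + r%:R) * a j 0.
      by move: tB => /(_ j); rewrite !mxE ler_norml.
    have -> : A *m t = \sum_(i <- enum 'I_r) (\sum_j t j 0 * c j i) *: col (J i) A.
      rewrite big_enum /=; under eq_bigr do rewrite scaler_suml.
      rewrite exchange_big/=; apply/colP => k; rewrite mxE summxE; apply: eq_bigr => j _.
      have [_ /colP/(_ k)] := Jc j; rewrite mxE => ->.
      rewrite mulrC !summxE mulr_sumr; apply: eq_bigr => i _.
      by rewrite !mxE mulrA.
    have := @iter_avg_shift_le R d _ (fun i => col (J i) A) (fun i => a (J i) 0)
      (fun i => a0 (J i)) (enum 'I_r) (fun i => \sum_j t j 0 * c j i) K0 g x K00.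
    rewrite size_enum_ord; apply => // i.
    apply: le_trans (ler_norm_sum _ _ _) _.
    rewrite /K0 -mulrA mulr_natl -[X in _ *+ X]card_ord -sumr_const.
    apply: ler_sum => j _; rewrite normrM.
    apply: (@le_trans _ _ ((1 + r%:R) * a j 0 * `|c j i|)); first exact: ler_wpM2r.
    rewrite -mulrA; apply: ler_wpM2l; first by rewrite addr_ge0.
    by rewrite mulrC; have [+ _] := Jc j; apply.
  rewrite integral_cst// EFinM -!muleA; apply: lee_wpmul2l; first by rewrite lee_fin; lra.
  rewrite muleCA; apply: lee_wpmul2l => //.
  by apply: borel_measure_box_scale; rewrite ltr_pwDl.
have CtCn0 : 0 < Ct * Cn by lra.
rewrite mulrC EFinM lte_pdivrMl//; apply: (lt_le_trans lV).
(* A zero volume would have inverse 0 by convention, and the average would be 0. *)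
have [V00|V00] := eqVneq (fine V) 0.
  by rewrite V00 invr0 mul0e mule_ge0// lee_fin ltW.
apply: le_trans (lee_wpmul2l _ intV) _; first by rewrite lee_fin invr_ge0.
by rewrite -{2}(fineK Vfin) muleCA -EFinM mulVf// mule1.
Qed.

(** * The theorem *)

Section Log_weight.
Context {R : realType}.

Lemma Log_ge0 m (t : R) : 0 <= t -> 0 <= Log m t.
Proof.
case: m => [|m] t0 //=; rewrite mulr_ge0// addr_ge0//.
by rewrite le_max lexx.
Qed.

Lemma measurable_Log m : measurable_fun [set: R] (@Log R m).
Proof.
case: m => [|m]/=; first exact: measurable_id.
apply: measurable_funM => //; apply: measurable_funD => //.
by apply: measurable_maxr => //; apply: measurable_funX; exact: measurable_ln.
Qed.

(** For positive [m], [1 + logp t] is at most 2 or at most [2 * logp t], according to whether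
    [logp t <= 1]. *)
Lemma Phi_le_Log m (t : R) : 0 <= t -> Phi m t <= 2 ^+ m * Log m t.
Proof.
case: m => [|m] t0; first by rewrite /Phi !expr0 mulr1 mul1r.
rewrite /Phi /Log mulrCA; apply: ler_wpM2l => //.
have lm : logp t ^+ m.+1 <= Num.max 0 (ln t ^+ m.+1).
  rewrite /logp; have [l0|l0] := leP (ln t) 0.
    by rewrite expr0n/= le_max lexx.
  by rewrite le_max lexx orbT.
apply: (@le_trans _ _ (2 ^+ m.+1 * (1 + logp t ^+ m.+1))); last first.
  by apply: ler_wpM2l; rewrite ?exprn_ge0// lerD2l.
have lt0 := logp_ge0 t; have lm0 : 0 <= logp t ^+ m.+1 by rewrite exprn_ge0.
have [l1|l1] := leP (logp t) 1.
  apply: (@le_trans _ _ (2 ^+ m.+1)); last by rewrite ler_peMr ?exprn_ge0// lerDl.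
  by apply: lerXn2r; rewrite ?nnegrE; lra.
apply: (@le_trans _ _ (2 ^+ m.+1 * logp t ^+ m.+1)).
  by rewrite -exprMn; apply: lerXn2r; rewrite ?nnegrE; lra.
by apply: ler_wpM2l; rewrite ?exprn_ge0// lerDr.
Qed.

End Log_weight.

Lemma measurable_norm_div (R : realType) {d'} (T : measurableType d') (f : T -> R)
    (c : R) : measurable_fun [set: T] f ->
  measurable_fun [set: T] (fun x => `|f x| / c).
Proof. by move=> mf; apply: measurable_funM => //; exact: measurableT_comp. Qed.

Lemma outer_measure_bigcup_finType (R : realType) (T : Type) (I : finType)
    (mu : {outer_measure set T -> \bar R}) (F : I -> set T) (c : \bar R) :
  (0 <= c)%E -> (forall i, mu (F i) <= c)%E ->
  (mu (\bigcup_i F i) <= (#|I|%:R)%:E * c)%E.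
Proof.
move=> c0 Fc; rewrite bigcup_mkcond.
rewrite (_ : \bigcup_i _ = \big[setU/set0]_(i : I) F i); last first.
  apply/seteqP; split => x.
    by move=> [i _]; rewrite in_setT => Fx; rewrite (bigD1 i)//=; left.
  by rewrite -bigcup_seq => -[i _ Fx]; exists i => //; rewrite in_setT.
rewrite -sum1_card natr_sum -sumEFin ge0_sume_distrl; last by move=> i _; rewrite lee_fin.
elim/big_ind2 : _ => [|A a B b Aa Bb|i _]; first by rewrite outer_measure0.
  by apply: le_trans (outer_measureU2 _ _ _) _; exact: leeD.
by rewrite mul1e.
Qed.

Theorem theorem1p3 (R : realType) (d n : nat) (A : 'M[R]_(d, n))
    (rA : (1 <= \rank A)%N) :
  exists C : R, 0 < C /\
    forall f : 'cV[R]_d -> R, LlogL (\rank A - 1) f ->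
    forall lambda : R, 0 < lambda ->
    (lebesgue_cV R d [set x | lambda%:E < maximal_function A f x] <=
     C%:E * \int[lebesgue_cV R d]_x (Log (\rank A - 1) (`|f x| / lambda))%:E)%E.
Proof.
set m := (\rank A - 1)%N; have mE : \rank A = m.+1 by rewrite /m subn1 prednK.
have [K K1 Kmax] := maximal_function_iter_maximal _ _ _ A.
have K0 : 0 < K by exact: lt_le_trans K1.
have [C C0 weak] := @iter_maximal_weak_type R d m.
(* A bound for the number of choices [J]; the successor makes it visibly positive. *)
pose N : R := (#|{ffun 'I_(\rank A) -> 'I_n}|.+1)%:R.
have N0 : 0 < N by rewrite ltr0n.
(* [C1] is the cost in [Phi_scale] of replacing the level [l / K] by [l], and [C2] that of passing
   from [Phi] to [Log]. *)
pose C1 := K * (1 + K) ^+ m; pose C2 : R := 2 ^+ m.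
have C10 : 0 < C1 by rewrite mulr_gt0// exprn_gt0// addr_gt0.
have C20 : 0 < C2 by rewrite exprn_gt0.
exists (N * (C * (C1 * C2))); split; first by do 3![apply: mulr_gt0 => //].
move=> f [mf _] l l0.
have [g [Z [mg fg mZ Z0 gf]]] := borel_majorant _ mf.
have g0 x : (0 <= g x)%E by apply: le_trans (fg x); rewrite lee_fin.
have l_ge0 x : 0 <= `|f x| / l by rewrite divr_ge0// ltW.
have lK0 : 0 < l / K by rewrite divr_gt0.
have gy : borel_measure R d [set x | g x = +oo%E] = 0%E.
  apply/eqP; rewrite eq_le measure_ge0 andbT -Z0.
  by apply: le_lebesgue_outer => x /= gx; apply: contrapT => /gf; rewrite gx.
set I := (\int[lebesgue_cV R d]_x (Log m (`|f x| / l))%:E)%E.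
have mfl c := measurable_norm_div _ (lebesgue_space R d) f c mf.
have PhiI : (\int[borel_measure R d]_x (Phi m (fine (g x) / (l / K)))%:E
    <= (C1 * C2)%:E * I)%E.
  have P0 x : 0 <= fine (g x) / (l / K) by rewrite divr_ge0 ?fine_ge0// ltW.
  have mPg := @measurable_Phi_fine R d m g (l / K) mg.
  rewrite ge0_integral_borel//; last by move=> x; rewrite lee_fin Phi_ge0.
  have -> : (\int[lebesgue_cV R d]_x (Phi m (fine (g x) / (l / K)))%:E =
      \int[lebesgue_cV R d]_x (Phi m (`|f x| / (l / K)))%:E)%E.
    apply: ge0_ae_eq_integral.
    - exact: measurableT.
    - move=> _ B mB; rewrite setTI; apply: borel_caratheodory.
      by rewrite -[X in measurable X]setTI; exact: mPg.
    - apply/measurable_EFinP; exact: (measurableT_comp (measurable_Phi m) (mfl _)).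
    - by move=> x _; rewrite lee_fin Phi_ge0.
    - by move=> x _; rewrite lee_fin Phi_ge0// divr_ge0// ltW.
    exists Z; split => // x /= /not_implyP[_] nP; apply: contrapT => /gf gx.
    by apply: nP; rewrite gx.
  rewrite /I -ge0_integralZl_EFin//; last 3 first.
  - by move=> x _; rewrite lee_fin Log_ge0.
  - by apply/measurable_EFinP; exact: (measurableT_comp (measurable_Log m) (mfl l)).
  - by rewrite mulr_ge0// ltW.
  apply: le_lower_integral => x _.
    by rewrite lee_fin Phi_ge0// divr_ge0// ltW.
  rewrite -EFinM lee_fin (_ : `|f x| / (l / K) = K * (`|f x| / l)); last first.
    by field; rewrite !gt_eqF.
  apply: le_trans (Phi_scale m _ _ K1 (l_ge0 x)) _; rewrite -[leRHS]mulrA.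
  by apply: ler_wpM2l; [exact: ltW|exact: Phi_le_Log].
have I0 : (0 <= (C1 * C2)%:E * I)%E.
  rewrite mule_ge0//; first by rewrite lee_fin mulr_ge0// ltW.
  by apply: integral_ge0 => x _; rewrite lee_fin Log_ge0.
pose F (J : {ffun 'I_(\rank A) -> 'I_n}) : set 'cV[R]_d :=
  [set x | ((l / K)%:E < iter_maximal [seq col (J i) A | i <- enum 'I_(\rank A)] g x)%E].
(* [lebesgue_cV] is the outer measure on every set, so monotonicity applies to the level set of
   [maximal_function] whether or not it is measurable. *)
apply: (@le_trans _ _ (lebesgue_outer R d (\bigcup_J F J))).
  apply: le_lebesgue_outer => x /= lx.
  by have [J FJ] := Kmax f g mg fg x l l0 lx; exists J.
apply: (@le_trans _ _ ((#|{ffun 'I_(\rank A) -> 'I_n}|%:R)%:E *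
    (C%:E * ((C1 * C2)%:E * I)))%E).
  apply: outer_measure_bigcup_finType; first by rewrite mule_ge0// lee_fin ltW.
  move=> J; apply: le_trans (weak _ _ g mg g0 gy _ lK0) _.
    by rewrite size_map size_enum_ord.
  by apply: lee_wpmul2l => //; rewrite lee_fin ltW.
rewrite [in leRHS]EFinM [in leRHS]EFinM -!muleA.
apply: lee_wpmul2r; first by rewrite mule_ge0// lee_fin ltW.
by rewrite lee_fin ler_nat.
Qed.
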